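(* Let $Y$ be an intensity-reweighted moment stationary (IRMS) spatio-temporal point process on $\mathbb{R}^d\times\mathbb{R}$, and let $r,t\ge 0$ be such that $J_{\rm inhom}(r,t)$ is defined (i.e. its defining series converges absolutely) and \[ \limsup_{n\to\infty}\left(\frac{\bar\lambda^n}{n!}\int_{S_r^t}\cdots\int_{S_r^t}\frac{\rho^{(n)}((x_1,t_1),\ldots,(x_n,t_n))}{\lambda(x_1,t_1)\cdots\lambda(x_n,t_n)}\prod_{i=1}^n dx_i\,dt_i\right)^{1/n}<1 . \] Assume in addition that $Y$ admits a Papangelou conditional intensity $\lambda(\cdot,\cdot;\cdot)$. For $(a,b)\in\mathbb{R}^d\times\mathbb{R}$ write \[ W_{(a,b)}(Y)=\prod_{(x,s)\in Y}\left(1-\frac{\bar\lambda\,\mathbf 1\{\|a-x\|\le r,\ |b-s|\le t\}}{\lambda(x,s)}\right). \] Then, for almost all $(a,b)\in\mathbb{R}^d\times\mathbb{R}$, $\mathbb{E}\left[\lambda(a,b;Y)W_{(a,b)}(Y)/\lambda(a,b)\right]>0$ implies $\mathbb{E}[W_{(a,b)}(Y)]>0$ and \[ J_{\rm inhom}(r,t)=\mathbb{E}\left[\frac{\lambda(a,b;Y)}{\lambda(a,b)}W_{(a,b)}(Y)\right]\Big/\ \mathbb{E}\left[W_{(a,b)}(Y)\right]. \]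
   Context: Let $d\ge1$; $\|\cdot\|$ is the Euclidean norm on $\mathbb{R}^d$, $\ell$ is Lebesgue measure on $\mathbb{R}^d\times\mathbb{R}$, and $S_r^t=\{(x,s)\in\mathbb{R}^d\times\mathbb{R}:\|x\|\le r,\ |s|\le t\}$. $N$ is the space of locally finite counting measures on $\mathbb{R}^d\times\mathbb{R}$ with the $\sigma$-algebra generated by the maps $\varphi\mapsto\varphi(A)$, $A$ Borel. A spatio-temporal point process (STPP) $Y$ is a random element of $N$ that is almost surely simple; it is identified with its random set of points. Empty products equal $1$. Product densities: $\rho^{(n)}$, $n\ge1$, are the permutation-invariant densities of the (locally finite) factorial moment measures of $Y$ with respect to the $n$-fold product of $\ell$: for all measurable $h\ge0$, $\mathbb{E}[\sum^{\neq}_{y_1,\ldots,y_n\in Y}h(y_1,\ldots,y_n)]=\int\cdots\int h\,\rho^{(n)}\,dy_1\cdots dy_n$, the sum being over $n$-tuples of pairwise distinct points of $Y$. The intensity function is $\lambda(x,t)=\rho^{(1)}(x,t)$, and $\bar\lambda=\inf_{(x,t)}\lambda(x,t)$. $n$-point correlation functions: $\xi_1\equiv1$ and, recursively in $n$, $\dfrac{\rho^{(n)}(y_1,\ldots,y_n)}{\prod_{k=1}^n\lambda(y_k)}=\sum_{k=1}^n\sum_{D_1,\ldots,D_k}\prod_{j=1}^k\xi_{|D_j|}(\{y_i:i\in D_j\})$, where the inner sum is over all partitions of $\{1,\ldots,n\}$ into $k$ non-empty sets $D_1,\ldots,D_k$. IRMS: $Y$ is intensity-reweighted moment stationary if product densities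 of all orders exist, $\bar\lambda>0$, and for every $n\ge1$, $\xi_n(y_1+c,\ldots,y_n+c)=\xi_n(y_1,\ldots,y_n)$ for almost all $y_1,\ldots,y_n\in\mathbb{R}^d\times\mathbb{R}$ and all $c\in\mathbb{R}^d\times\mathbb{R}$. Translation-invariant versions of $\xi_n$ are used when evaluating with one argument equal to the origin $(0,0)$. Inhomogeneous $J$-function of an IRMS STPP: $J_n(r,t)=\int_{S_r^t}\cdots\int_{S_r^t}\xi_{n+1}((0,0),(x_1,t_1),\ldots,(x_n,t_n))\prod_{i=1}^n dx_i\,dt_i$ and $J_{\rm inhom}(r,t)=1+\sum_{n=1}^\infty\frac{(-\bar\lambda)^n}{n!}J_n(r,t)$, for all $r,t\ge0$ for which the series is absolutely convergent. Papangelou conditional intensity: a non-negative measurable function $\lambda(x,t;\varphi)$ on $\mathbb{R}^d\times\mathbb{R}\times N$ such that $\mathbb{E}[\sum_{(x,t)\in Y}g(x,t,Y\setminus\{(x,t)\})]=\int_{\mathbb{R}^d\times\mathbb{R}}\mathbb{E}[g(x,t,Y)\lambda(x,t;Y)]\,dx\,dt$ for every measurable $g\ge0$ on $\mathbb{R}^d\times\mathbb{R}\times N$. *)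

(* Defs.v *)
From HB Require Import structures.
From mathcomp Require Import all_boot all_order all_algebra perm.
From mathcomp Require Import all_classical all_reals all_analysis.
From mathcomp Require Import measurable_realfun.

Set Implicit Arguments.
Unset Strict Implicit.
Unset Printing Implicit Defensive.

Import Order.TTheory GRing.Theory Num.Theory.
Import numFieldNormedType.Exports.

Local Open Scope classical_set_scope.
Local Open Scope ring_scope.
Local Open Scope ereal_scope.

(* The measure m1 \x m2, under a name of its own because the inferred
   sigma-finite structure of m1 \x m2 is the one for subprobabilities. *)
Section sigma_finite_product.
Context d1 d2 (T1 : measurableType d1) (T2 : measurableType d2) (R : realType).
Variable m1 : {sigma_finite_measure set T1 -> \bar R}.
Variable m2 : {sigma_finite_measure set T2 -> \bar R}.

Definition sfprod : set (T1 * T2) -> \bar R := m1 \x m2.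

HB.instance Definition _ := Measure.on sfprod.

Let sfprod_sigma_finite : sigma_finite setT sfprod.
Proof.
have /sigma_finiteP[F [TF ndF Foo]] := sigma_finiteT m1.
have /sigma_finiteP[G [TG ndG Goo]] := sigma_finiteT m2.
exists (fun n => F n `*` G n).
  rewrite -setXTT TF TG predeqE => -[x y]; split.
    move=> [/= [n _ Fnx] [k _ Gky]]; exists (maxn n k) => //; split.
    - by move: x Fnx; exact/subsetPset/ndF/leq_maxl.
    - by move: y Gky; exact/subsetPset/ndG/leq_maxr.
  by move=> [n _ []/= ? ?]; split; exists n.
move=> k; have [? ?] := Foo k; have [? ?] := Goo k.
split; first exact: measurableX.
by rewrite /sfprod product_measure1E// lte_mul_pinfty// ge0_fin_numE.
Qed.

HB.instance Definition _ :=
  Measure_isSigmaFinite.Build _ _ _ sfprod sfprod_sigma_finite.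

End sigma_finite_product.

Section tuple_power.
Context disp (T : measurableType disp) (R : realType).

Definition cons_pair n (p : T * n.-tuple T) : n.+1.-tuple T :=
  [tuple of p.1 :: p.2].

Lemma measurable_cons_pair n : measurable_fun setT (@cons_pair n).
Proof. by apply: measurable_cons. Qed.

Lemma cons_pair_inj n : injective (@cons_pair n).
Proof.
by move=> [x s] [y t] /= /(congr1 val) /= [-> st]; congr pair; apply: val_inj.
Qed.

Section dirac0.
Definition tuple_power0 : set (0.-tuple T) -> \bar R := \d_([tuple]).

HB.instance Definition _ := Measure.on tuple_power0.

Let tuple_power0_sigma_finite : sigma_finite setT tuple_power0.
Proof.
apply: fin_num_fun_sigma_finite => [|A mA]; first by rewrite measure0.
exact: fin_num_measure.
Qed.

HB.instance Definition _ :=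
  Measure_isSigmaFinite.Build _ _ _ tuple_power0 tuple_power0_sigma_finite.
End dirac0.

Section cons_measure.
Variable mu : {sigma_finite_measure set T -> \bar R}.
Variables (n : nat) (nu : {sigma_finite_measure set (n.-tuple T) -> \bar R}).

Definition cons_measure : set (n.+1.-tuple T) -> \bar R :=
  pushforward (sfprod mu nu) (@cons_pair n).

Let cons_measure0 : cons_measure set0 = 0.
Proof. by rewrite /cons_measure /pushforward preimage_set0 measure0. Qed.

Let cons_measure_ge0 A : 0 <= cons_measure A.
Proof. by apply: integral_ge0 => x _; exact: measure_ge0. Qed.

Let cons_measure_sigma_additive : semi_sigma_additive cons_measure.
Proof.
move=> F mF tF mUF; rewrite /cons_measure /pushforward preimage_bigcup.
have mc := @measurable_cons_pair n.
apply: measure_semi_sigma_additive.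
- by move=> k; rewrite -[X in measurable X]setTI; exact: mc.
- apply/trivIsetP => /= i j _ _ ij; rewrite -preimage_setI.
  by move/trivIsetP : tF => /(_ _ _ _ _ ij) ->//; rewrite preimage_set0.
- by rewrite -preimage_bigcup -[X in measurable X]setTI; exact: mc.
Qed.

HB.instance Definition _ := isMeasure.Build _ _ _ cons_measure
  cons_measure0 cons_measure_ge0 cons_measure_sigma_additive.

Let cons_measure_sigma_finite : sigma_finite setT cons_measure.
Proof.
have [F TF Foo] := sigma_finiteT (sfprod mu nu).
pose h (s : n.+1.-tuple T) : T * n.-tuple T := (thead s, [tuple of behead s]).
have mh : measurable_fun setT h.
  by apply/measurable_fun_pair => //=;
    [exact: measurable_tnth | exact: measurable_behead].
have hK s : cons_pair (h s) = s by rewrite /cons_pair /h /= -tuple_eta.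
have cK p : h (cons_pair p) = p by apply: cons_pair_inj; rewrite hK.
exists (fun k => h @^-1` F k) => [|k].
  by rewrite -preimage_bigcup -TF preimage_setT.
have [mFk Fkoo] := Foo k; split.
  by rewrite -[X in measurable X]setTI; exact: mh.
rewrite /cons_measure /pushforward (_ : _ @^-1` _ = F k)//.
by apply/seteqP; split => p /=; rewrite cK.
Qed.

HB.instance Definition _ := Measure_isSigmaFinite.Build _ _ _ cons_measure
  cons_measure_sigma_finite.
End cons_measure.

(* The n-fold product measure of mu. *)
Fixpoint tuple_power (mu : {sigma_finite_measure set T -> \bar R}) (n : nat) :
    {sigma_finite_measure set (n.-tuple T) -> \bar R} :=
  if n is m.+1 then cons_measure mu (tuple_power mu m) else tuple_power0.

End tuple_power.


(* lebesgue_measure lives on measurableTypeR R, which carries the sigma-algebra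
   of R under another display; lebesgue_line is the same function on R. *)
Section lebesgue_line.
Context (R : realType).

Definition lebesgue_line : set R -> \bar R := @lebesgue_measure R.

Let lebesgue_line0 : lebesgue_line set0 = 0.
Proof. exact: (measure0 (@lebesgue_measure R)). Qed.

Let lebesgue_line_ge0 A : 0 <= lebesgue_line A.
Proof. exact: (measure_ge0 (@lebesgue_measure R)). Qed.

Let lebesgue_line_sigma_additive : semi_sigma_additive lebesgue_line.
Proof. exact: (@measure_semi_sigma_additive _ _ _ (@lebesgue_measure R)). Qed.

HB.instance Definition _ := isMeasure.Build _ _ _ lebesgue_line
  lebesgue_line0 lebesgue_line_ge0 lebesgue_line_sigma_additive.

Let lebesgue_line_sigma_finite : sigma_finite setT lebesgue_line.
Proof. exact: (sigma_finiteT (@lebesgue_measure R)). Qed.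

HB.instance Definition _ := Measure_isSigmaFinite.Build _ _ _ lebesgue_line
  lebesgue_line_sigma_finite.

End lebesgue_line.

Notation spacetime R d := (d.-tuple R * R)%type.

Section space_time.
Context (R : realType) (d : nat).
Implicit Types (x y c : spacetime R d) (r t : R).

Definition lebesgue_spacetime : {sigma_finite_measure set (spacetime R d) -> \bar R} :=
  sfprod (tuple_power (@lebesgue_line R) d) (@lebesgue_line R).

Definition origin : spacetime R d := ([tuple 0%R | i < d], 0%R).

Definition translate c y : spacetime R d :=
  ([tuple tnth y.1 i + tnth c.1 i | i < d], y.2 + c.2)%R.

Definition enorm (v : d.-tuple R) : R :=
  Num.sqrt (\sum_(i < d) tnth v i ^+ 2)%R.

Definition cyl r t : set (spacetime R d) :=
  [set y | (enorm y.1 <= r)%R /\ (`|y.2| <= t)%R].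

Definition cyln r t n : set (n.-tuple (spacetime R d)) :=
  [set z | forall i, cyl r t (tnth z i)].

Definition point_bounded (B : set (spacetime R d)) := exists r t, B `<=` cyl r t.

(* Two configurations that agree on measurable sets may differ as records; the
   sigma-algebra below does not separate them. *)
Record config := Config {
  config_measure :> {measure set (spacetime R d) -> \bar R} ;
  config_counting : forall A, measurable A ->
    config_measure A = +oo \/ exists n : nat, config_measure A = n%:R%:E ;
  config_locally_finite : forall B, measurable B -> point_bounded B ->
    config_measure B < +oo }.

HB.instance Definition _ := gen_eqMixin config.
HB.instance Definition _ := gen_choiceMixin config.

Lemma mzero_counting (A : set (spacetime R d)) : measurable A ->
  @mzero _ (spacetime R d) R A = +oo \/ exists n : nat, @mzero _ (spacetime R d) R A = n%:R%:E.
Proof. by move=> _; right; exists 0%N. Qed.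

Lemma mzero_locally_finite (B : set (spacetime R d)) :
  measurable B -> point_bounded B -> @mzero _ (spacetime R d) R B < +oo.
Proof. by move=> _ _; exact: ltry. Qed.

HB.instance Definition _ :=
  isPointed.Build config (Config mzero_counting mzero_locally_finite).

Definition config_measurable : set (set config) :=
  <<s \bigcup_(A in measurable)
        preimage_set_system setT (fun phi : config => phi A) measurable >>.

Let config_measurable_set0 : config_measurable set0.
Proof. exact: sigma_algebra0. Qed.

Let config_measurableC U : config_measurable U -> config_measurable (~` U).
Proof. exact: sigma_algebraC. Qed.

Let config_measurable_bigcup (F : (set config)^nat) :
  (forall i, config_measurable (F i)) -> config_measurable (\bigcup_i F i).
Proof. exact: sigma_algebra_bigcup. Qed.

Definition config_display : measure_display.
Proof. by constructor. Qed.

HB.instance Definition _ := @isMeasurable.Build config_display config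
  config_measurable config_measurable_set0 config_measurableC
  config_measurable_bigcup.

Definition simple_config (phi : config) := forall y, phi [set y] <= 1.

Definition points (phi : config) : set (spacetime R d) :=
  [set y | phi [set y] != 0].

Definition distinct_points n (phi : config) : set (n.-tuple (spacetime R d)) :=
  [set z : n.-tuple (spacetime R d) | uniq z /\ forall i, points phi (tnth z i)].

Lemma measurable_point1 y : measurable [set y].
Proof.
case: y => v s.
have -> : [set (v, s)] = [set v] `*` [set s].
  by apply/seteqP; split => [_ -> //|[a b] [/= -> ->]].
apply: measurableX; last exact: measurable_set1.
have -> : [set v] =
    \bigcap_(i in [set: 'I_d]) ((@tnth _ R ^~ i) @^-1` [set tnth v i]).
  apply/seteqP; split => [_ -> //|w /= vw].
  by apply: eq_from_tnth => i; exact: vw.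
apply: fin_bigcap_measurable => // i _; rewrite -[X in measurable X]setTI.
by apply: measurable_tnth.
Qed.

Section remove.
Variables (phi : config) (y : spacetime R d).
Let rest := mrestr phi (measurableC (measurable_point1 y)).

Let rest_counting A : measurable A ->
  rest A = +oo \/ exists n : nat, rest A = n%:R%:E.
Proof.
move=> mA; apply: config_counting; apply: measurableI => //.
exact: measurableC (measurable_point1 y).
Qed.

Let rest_locally_finite B : measurable B -> point_bounded B -> rest B < +oo.
Proof.
move=> mB [r [t Brt]]; apply: config_locally_finite.
  by apply: measurableI => //; exact: measurableC (measurable_point1 y).
by exists r, t => x [/Brt].
Qed.

(* Deletes the point y of phi: phi is restricted to the complement of y. *)
Definition remove : config := Config rest_counting rest_locally_finite.
End remove.

End space_time.

Arguments cyln {R d} r t n.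
Arguments distinct_points {R d} n phi.

Section point_process.
Context (R : realType) (d : nat) (dO : measure_display)
  (Omega : measurableType dO) (P : probability Omega R).
Variable Y : {RV P >-> config R d}.

Notation E := (spacetime R d).
Notation pointn n := (tuple_power (lebesgue_spacetime R d) n).

Definition simple_process := \forall w \ae P, simple_config (Y w).

Definition factorial_moment n (h : n.-tuple E -> \bar R) : \bar R :=
  \int[P]_w \esum_(z in distinct_points n (Y w)) h z.

Definition product_density n (rho : n.-tuple E -> R) : Prop :=
  [/\ measurable_fun setT rho,
      forall z, (0 <= rho z)%R,
      forall (s : {perm 'I_n}) z, rho [tuple tnth z (s i) | i < n] = rho z,
      forall r t, factorial_moment (fun z => (\1_(cyln r t n) z)%:E) < +oo
    & forall h : n.-tuple E -> \bar R,
        measurable_fun setT h -> (forall z, 0 <= h z) ->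
        factorial_moment h = \int[pointn n]_z (h z * (rho z)%:E) ].

Definition intensity (rho : forall n, n.-tuple E -> R) (y : E) : R :=
  rho 1%N [tuple y].

Definition intensity_inf (rho : forall n, n.-tuple E -> R) : R :=
  inf (range (intensity rho)).

Definition reweighted_density (rho : forall n, n.-tuple E -> R) n
    (z : n.-tuple E) : R :=
  (rho n z / \prod_(i < n) intensity rho (tnth z i))%R.

(* The points y_i, i in D, are listed by increasing index. *)
Definition subtuple n (z : n.-tuple E) (D : {set 'I_n}) : #|D|.-tuple E :=
  [tuple of map (tnth z) (enum_tuple (mem D))].

Definition correlation_functions (rho xi : forall n, n.-tuple E -> R) : Prop :=
  (forall z, xi 1%N z = 1%R) /\
  forall n (z : n.-tuple E), (0 < n)%N ->
    reweighted_density rho z =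
    (\sum_(Q : {set {set 'I_n}} | finset.partition Q [set: 'I_n]%SET)
       \prod_(D in Q) xi #|D| (subtuple z D))%R.

Definition translate_tuple n (c : E) (z : n.-tuple E) : n.-tuple E :=
  [tuple of map (translate c) z].

(* In IRMS_stationary the exceptional null set may depend on c. *)
Record IRMS (rho xi : forall n, n.-tuple E -> R) : Prop := {
  IRMS_density : forall n, (0 < n)%N -> product_density (@rho n) ;
  IRMS_intensity : (0 < intensity_inf rho)%R ;
  IRMS_correlation : correlation_functions rho xi ;
  IRMS_stationary : forall n, (0 < n)%N -> forall c : E,
    \forall z \ae pointn n, xi n (translate_tuple c z) = xi n z }.

Definition invariant_version (xi xi' : forall n, n.-tuple E -> R) : Prop :=
  forall n, (0 < n)%N ->
  [/\ measurable_fun setT (@xi' n),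
      forall c z, xi' n (translate_tuple c z) = xi' n z
    & \forall z \ae pointn n, xi' n z = xi n z].

(* In the definitions below, xi' is an invariant version of the correlation
   functions. *)
Definition J_coef (xi' : forall n, n.-tuple E -> R) (r t : R) n : R :=
  (\int[pointn n]_(z in cyln r t n) xi' n.+1 [tuple of origin R d :: z])%R.

Definition J_term (rho xi' : forall n, n.-tuple E -> R) (r t : R) n : R :=
  ((- intensity_inf rho) ^+ n / n`!%:R * J_coef xi' r t n)%R.

Definition J_inhom_defined (rho xi' : forall n, n.-tuple E -> R) (r t : R) :=
  cvgn (fun N => \sum_(1 <= n < N) `|J_term rho xi' r t n|)%R.

Definition J_inhom (rho xi' : forall n, n.-tuple E -> R) (r t : R) : R :=
  (1 + limn (fun N => \sum_(1 <= n < N) J_term rho xi' r t n))%R.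

Record papangelou (plam : E * config R d -> R) : Prop := {
  papangelou_measurable : measurable_fun setT plam ;
  papangelou_ge0 : forall u, (0 <= plam u)%R ;
  papangelou_GNZ : forall g : E * config R d -> \bar R,
    measurable_fun setT g -> (forall u, 0 <= g u) ->
    \int[P]_w (\esum_(y in points (Y w)) g (y, remove (Y w) y)) =
    \int[lebesgue_spacetime R d]_y
      \int[P]_w (g (y, Y w) * (plam (y, Y w))%:E) }.

(* Only finitely many points of phi have a factor different from 1, so this
   finitely supported product never takes its default value. *)
Definition W_prod (rho : forall n, n.-tuple E -> R) (r t : R) (a : E)
    (phi : config R d) : R :=
  (\big[*%R/1]_(y \in points phi)
     (1 - intensity_inf rho *
            \1_[set u : E | enorm [tuple tnth a.1 i - tnth u.1 i | i < d] <= r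
                            /\ `|a.2 - u.2| <= t] y
          / intensity rho y))%R.

End point_process.

(* Main.v *)
Require Import Defs.
From HB Require Import structures.
From mathcomp Require Import all_boot all_order all_algebra perm.
From mathcomp Require Import all_classical all_reals all_analysis.
From mathcomp Require Import measurable_realfun.
From mathcomp Require Import ring.

Set Implicit Arguments.
Unset Strict Implicit.
Unset Printing Implicit Defensive.

Import Order.TTheory GRing.Theory Num.Theory.
Import numFieldNormedType.Exports.

Local Open Scope classical_set_scope.
Local Open Scope ring_scope.
Local Open Scope ereal_scope.

(** Write g_n for the reweighted density rho_n / (lambda x ... x lambda), Lam for the infimum of the
intensity and u a y = Lam 1(y in the window of a) / lambda y, so that 0 <= u a y <= 1 and W is
the product of the factors 1 - u a y over the points y.  On a simple configuration only finitely
many factors differ from 1, and expanding the product gives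
  W_a = sum_n (-1)^n / n! S_n(a),
where S_n(a) sums u a y_1 ... u a y_n over the ordered n-tuples of distinct points
([alternating_distinct_sum], [W_prod_expansion]).  The theorem compares the expectations of the
two sides, without and with the weight lambda(a; Y) / lambda(a).

Without the weight, the definition of the product densities gives E S_n(a) = Lam^n G_n, where
G_n is the integral of g_n over the n-th power of the window at the origin.  The window can be
moved to the origin because g_n is built from the correlation functions and inherits their
invariance ([mean_factorial_sum], [window_momentE]).

With the weight, the Georgii-Nguyen-Zessin formula turns E (lambda(a; Y) S_n(a)), integrated
over a set of points a, into a factorial moment of order n + 1.  Hence, for almost every a,
E (lambda(a; Y) S_n(a)) / lambda(a) = Lam^n H_n(a), with H_n(a) the integral of g_(n+1)(a, z)
over z in the n-th power of the window of a ([palm_mass_moment]).  Sorting the partitions of the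
n + 1 points by the block D of the point a,
  g_(n+1)(a, z) = sum_D xi(a, z_D) g(z_(complement of D))
([rw_density_cons]), and D and its complement carry disjoint variables.  So H_n is the sum over
k of binomial(n, k) J_k G_(n-k) ([ae_palm_moment], [sum_masks_binomial]): the exponential
generating series of H is the product of those of J and G.

The first of these two series converges absolutely by assumption, the second by the root test.
Their Cauchy product therefore converges absolutely too
([is_cvg_normed_cauchy_product], [cvg_cauchy_product]), dominated convergence allows
both expansions to be integrated term by term ([integral_alternating_series]), and
  E (lambda(a; Y) / lambda(a) W_a) = J E W_a.
As W >= 0, positivity of the left-hand side forces E W_a > 0.

Three things need care.  The correlation functions must be integrable over bounded sets before
J_k can be handled as an integral: by induction on the order, the recursion above expresses the
correlation function of highest order by g and by products of correlation functions of lower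
order ([seq_integral_correlation_lty]).  Sums over the points of a configuration must be
measurable: locally finite counting measures are shown to be sums of atoms, so these sums are
integrals against the configuration, and configurations form a kernel ([integral_config],
[measurable_integral_config]).  Finally the process is simple only almost surely, and off that
event the sums need not be measurable, so one first passes to an everywhere simple version
([exists_simple_version], [ge0_ae_eq_integral_nonmeasurable]). *)

(** * Set partitions split by one block *)

Section partition_sum.
Context (I : finType) (K : comPzRingType) (f : {set I} -> K).
Implicit Types (A B : {set I}).

Definition partition_sum A : K :=
  (\sum_(Q : {set {set I}} | finset.partition Q A) \prod_(D in Q) f D)%R.

Lemma partition_sum0 : partition_sum finset.set0 = 1%R.
Proof.
rewrite /partition_sum (eq_bigl (pred1 finset.set0)); last first.
  by move=> Q; rewrite partition_set0.
by rewrite big_pred1_eq big_pred0// => D; rewrite inE.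
Qed.

(** A partition of A is the block B of x together with a partition of the rest of A. *)
Lemma partition_sum_rec A x : x \in A ->
  partition_sum A =
  (\sum_(B : {set I} | (x \in B) && (B \subset A)) f B * partition_sum (A :\: B))%R.
Proof.
move=> xA; rewrite /partition_sum.
rewrite (partition_big (fun Q => finset.pblock Q x)
  (fun B : {set I} => (x \in B) && (B \subset A))) => [|Q PQ]; last first.
  have xQ : x \in finset.cover Q by rewrite (cover_partition PQ).
  by rewrite mem_pblock xQ/= (partitionS PQ)// pblock_mem.
apply: eq_bigr => B /andP[xB BA]; rewrite big_distrr/=.
have B0 : B != finset.set0 by apply/set0Pn; exists x.
rewrite (reindex_onto (fun Q => B |: Q) (fun Q => Q :\ B))/=; last first.
  move=> Q /andP[PQ /eqP <-]; rewrite finset.setD1K// pblock_mem//.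
  by rewrite (cover_partition PQ).
apply: eq_big => [Q|Q].
- apply/idP/idP.
  + case/andP=> /andP[PQ /eqP bQ] /eqP QE.
    have BQ : B \in B |: Q by rewrite !inE eqxx.
    by move: (partitionD1 PQ BQ); rewrite QE.
  + move=> PQ.
    have dAB : [disjoint B & A :\: B]%bool.
      by rewrite fintype.disjoint_sym finset.disjoints_subset;
        apply/fintype.subsetP => y; rewrite !inE => /andP[].
    have BnQ : B \notin Q.
      apply/negP => /(partitionS PQ) /fintype.subsetP /(_ _ xB).
      by rewrite !inE xB.
    have UA : B :|: A :\: B = A.
      by rewrite -[RHS](finset.setID A B) (finset.setIidPr BA).
    have PU : finset.partition (B |: Q) A.
      have := partitionU1 PQ B0 dAB.
      by rewrite UA.
    rewrite PU/= finset.setU1K// eqxx andbT; apply/eqP.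
    have [_ tQ _] := and3P PU.
    by apply: def_pblock => //; rewrite !inE eqxx.
- case/andP=> /andP[PQ _] /eqP QE; rewrite big_setU1//=.
  by rewrite -QE !inE eqxx.
Qed.
End partition_sum.

(** Masks list the ways to split a sequence into two complementary subsequences. Unlike
subsets of the index set they commute with cons and map, which all the inductions below rely
on. *)
Fixpoint masks (n : nat) : seq bitseq :=
  if n is m.+1 then map (cons true) (masks m) ++ map (cons false) (masks m)
  else [:: [::]].

Lemma size_masks n b : b \in masks n -> size b = n.
Proof.
elim: n b => [|n IH] b /=; first by rewrite mem_seq1 => /eqP ->.
by rewrite mem_cat => /orP[] /mapP[c /IH <- ->].
Qed.

Section sum_over_masks.
Context (I : finType) (K : nmodType).

Lemma sum_subsets_cons (x : I) (l : seq I) (psi : {set I} -> K) :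
  x \notin l ->
  (\sum_(B : {set I} | (x \in B) && (B \subset [set y in x :: l]%SET)) psi B =
   \sum_(B : {set I} | B \subset [set y in l]%SET) psi (x |: B)%SET)%R.
Proof.
move=> xl; rewrite (reindex_onto (fun B => x |: B) (fun B => B :\ x))/=; last first.
  by move=> B /andP[xB _]; rewrite finset.setD1K.
apply: eq_bigl => B; rewrite !inE eqxx/=; apply/idP/idP.
- move=> /andP[/fintype.subsetP BS /eqP BE]; apply/fintype.subsetP => y yB.
  have : y \in (x |: B) :\ x by rewrite BE.
  rewrite !inE => /andP[yx _].
  by have := BS y; rewrite !inE (negbTE yx) yB/=; apply.
- move=> /fintype.subsetP BS; apply/andP; split.
    apply/fintype.subsetP => y; rewrite !inE => /orP[->//|/BS].
    by rewrite !inE => ->; rewrite orbT.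
  rewrite finset.setU1K//; apply/negP => /BS.
  by rewrite inE (negbTE xl).
Qed.

(** By induction on l, according to whether the head is in the subset, that is, to the first
bit of the mask. *)
Lemma sum_subsets_masks (l : seq I) (psi : {set I} -> K) : uniq l ->
  (\sum_(B : {set I} | B \subset [set y in l]%SET) psi B =
   \sum_(b <- masks (size l)) psi [set y in mask b l]%SET)%R.
Proof.
elim: l psi => [|x l IH] psi /=.
  move=> _; rewrite big_seq1/= (eq_bigl (pred1 finset.set0)); last first.
    by move=> B; rewrite finset.set_nil finset.subset0.
  by rewrite big_pred1_eq finset.set_nil.
case/andP=> xl ul; rewrite (bigID (fun B : {set I} => x \in B))/=.
rewrite big_cat !big_map/=; congr +%R.
  under eq_bigl do rewrite andbC.
  rewrite sum_subsets_cons// (IH (fun B => psi (x |: B)%SET))//.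
  by apply: eq_bigr => b _; rewrite finset.set_cons.
rewrite -(IH psi)//; apply: eq_bigl => B; apply/idP/idP.
  case/andP=> /fintype.subsetP BS xB; apply/fintype.subsetP => y yB.
  move: (BS _ yB); rewrite !inE => /orP[/eqP yx|//].
  by move: xB; rewrite -yx yB.
move=> /fintype.subsetP BS; apply/andP; split.
  by apply/fintype.subsetP => y /BS; rewrite !inE => ->; rewrite orbT.
by apply/negP => /BS; rewrite inE (negbTE xl).
Qed.

End sum_over_masks.

(** Subtuples are listed by increasing index, so reading them along a mask of the index list
gives the same sequence and not only a permutation of it. *)
Lemma enum_subseq (I : finType) (l : seq I) : subseq l (enum I) ->
  enum [set y in l]%SET = l.
Proof.
move=> sl; have /subseq_uniqP {2}-> := sl; last exact: enum_uniq.
by rewrite {1}/enum_mem -enumT; apply: eq_filter => y /=; rewrite inE.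
Qed.

Lemma mask_complement (I : finType) (x : I) (l : seq I) b :
  uniq (x :: l) -> size b = size l ->
  ([set y in x :: l] :\: [set y in x :: mask b l] =
   [set y in mask (map negb b) l])%SET.
Proof.
move=> /andP[xl ul] sb; apply/setP => y; rewrite !inE negb_or.
case: (eqVneq y x) => [->|_]/=.
  by apply/esym/negP => /mem_mask; rewrite (negbTE xl).
elim: l b ul sb {xl} => [|z l IH] [|[] b]//= /andP[zl ul] [] sb.
- rewrite !inE negb_or; case: (eqVneq y z) => [->|_]/=; last exact: IH.
  by apply/esym/negP => /mem_mask; rewrite (negbTE zl).
- rewrite !inE; case: (eqVneq y z) => [->|_]/=; last exact: IH.
  by rewrite andbT; apply/negP => /mem_mask; rewrite (negbTE zl).
Qed.

Section block_recursion.
Context (T : Type) (K : comPzRingType) (X : seq T -> K).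

(** The sum over set partitions as a recursion on sequences: the first entry chooses its
block, then the recursion goes on with the other entries. The fuel k stands in for the size,
since the complement of the block is not a subterm. *)
Fixpoint block_sum (k : nat) (s : seq T) : K :=
  match k, s with
  | k'.+1, x :: s' => (\sum_(b <- masks (size s'))
       X (x :: mask b s') * block_sum k' (mask (map negb b) s'))%R
  | _, [::] => 1%R
  | 0%N, _ => 0%R
  end.

(** Stated for all subsets A of a fixed index set: the recursion leaves the set of all
indices at the first step. *)
Lemma partition_sum_block_sum (I : finType) (t : I -> T) k (A : {set I}) :
  (#|A| <= k)%N ->
  partition_sum (fun D => X [seq t i | i <- enum D]) A =
  block_sum k [seq t i | i <- enum A].
Proof.
elim: k A => [|k IH] A Ak.
  have -> : A = finset.set0 by apply/eqP; rewrite -finset.cards_eq0 -leqn0.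
  by rewrite partition_sum0 enum_set0.
case E : (enum A) => [|x l].
  have -> : A = finset.set0 by rewrite -(finset.set_enum A) E finset.set_nil.
  by rewrite partition_sum0.
have AE : A = [set y in x :: l]%SET by rewrite -E finset.set_enum.
have sub : subseq (x :: l) (enum I) by rewrite -E {1}/enum_mem -enumT filter_subseq.
have uxl : uniq (x :: l) by rewrite -E enum_uniq.
have [xl ul] := andP uxl.
have xA : x \in A by rewrite AE !inE eqxx.
rewrite (partition_sum_rec _ xA) {1}AE.
rewrite (sum_subsets_cons (fun B => X [seq t i | i <- enum B] *
  partition_sum (fun D => X [seq t i | i <- enum D]) (A :\: B))%R xl).
rewrite (sum_subsets_masks (fun B => X [seq t i | i <- enum (x |: B)%SET] *
  partition_sum (fun D => X [seq t i | i <- enum D]) (A :\: (x |: B)%SET))%R ul).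
rewrite /= size_map !big_seq; apply: eq_bigr => b /size_masks sb.
have subm c : subseq (mask c l) (enum I).
  apply: subseq_trans (mask_subseq c l) _; apply: subseq_trans sub.
  exact: subseq_cons.
have subx : subseq (x :: mask b l) (enum I).
  by apply: subseq_trans sub; rewrite /= eqxx mask_subseq.
rewrite -finset.set_cons enum_subseq// AE mask_complement// IH ?enum_subseq//.
  by rewrite /= !map_mask.
rewrite -(mask_complement uxl sb) -AE -ltnS; apply: leq_trans Ak.
apply: proper_card; rewrite finset.properEneq finset.subsetDl andbT.
by apply/eqP => /setP/(_ x); rewrite !inE eqxx xA.
Qed.

Lemma block_sum_fuel k m s : (size s <= k)%N -> (size s <= m)%N ->
  block_sum k s = block_sum m s.
Proof.
elim: k m s => [|k IH] [|m] [|x s]//=; rewrite !ltnS => sk sm; rewrite !big_seq.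
apply: eq_bigr => b /size_masks sb; congr (_ * _)%R.
have sbs : (size (mask (map negb b) s) <= size s)%N.
  by rewrite size_mask ?size_map// count_map -sb count_size.
by apply: IH; exact: leq_trans sbs _.
Qed.
End block_recursion.

(** * Reweighted densities as functions of sequences *)

(** A family of functions of tuples as one function of sequences. A subsequence selected by
a mask then needs no cast to a tuple of the right length. *)
Definition seqfun T U (f : forall n, n.-tuple T -> U) (s : seq T) : U :=
  f (size s) (in_tuple s).

Lemma seqfunE T U (f : forall n, n.-tuple T -> U) n (z : n.-tuple T) :
  seqfun f z = f n z.
Proof.
case: z => s sn; have E := eqP sn; move: sn; rewrite /seqfun /=; case: _ / E => sn.
by congr f; apply: val_inj.
Qed.

Section reweighted.
Context (R : realType) (d : nat).
Variables rho xi : forall n, n.-tuple (spacetime R d) -> R.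
Hypothesis cor : correlation_functions rho xi.
Local Notation E := (spacetime R d).
Implicit Types (s : seq E) (x : E).

(** The reweighted density of a sequence of any length. Densities of order 0 carry no
meaning; the value 1 for the empty sequence makes [rw_density_cons] hold when the block of x
takes all points. *)
Definition rw_density s : R :=
  if s is [::] then 1%R else seqfun (@reweighted_density R d rho) s.

Lemma rw_densityE n (z : n.+1.-tuple E) : rw_density z = reweighted_density rho z.
Proof. by rewrite -seqfunE; case: z => -[]. Qed.

Lemma rw_density_block_sum k s : (size s <= k)%N -> rw_density s =
  block_sum (seqfun xi) k s.
Proof.
move=> sk; case: s sk => [|x s] sk; first by case: k sk.
rewrite -[x :: s]/(val (in_tuple (x :: s))); set z := in_tuple _.
rewrite rw_densityE /= cor.2//.
rewrite (@block_sum_fuel _ _ _ k (size (x :: s)) (x :: s))//.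
rewrite -[X in _ = block_sum _ _ X](map_tnth_enum z).
have <- : enum [set: 'I_(size (x :: s))]%SET = enum 'I_(size (x :: s)).
  by apply: eq_enum => i; rewrite inE.
rewrite -partition_sum_block_sum; last first.
  by rewrite finset.cardsT card_ord.
rewrite /partition_sum; apply: eq_bigr => Q _; apply: eq_bigr => D _.
by rewrite -seqfunE.
Qed.

(** The block of the first point x is selected by a mask, and the partitions of the
remaining points add up to their own reweighted density. *)
Lemma rw_density_cons x s :
  rw_density (x :: s) = (\sum_(b <- masks (size s))
    seqfun xi (x :: mask b s) * rw_density (mask (map negb b) s))%R.
Proof.
rewrite (@rw_density_block_sum (size s).+1)//= !big_seq.
apply: eq_bigr => b /size_masks sb; congr (_ * _)%R.
rewrite -rw_density_block_sum// size_mask ?size_map// count_map -sb.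
exact: count_size.
Qed.

(** Unfolding [rw_density_cons] repeatedly only ever evaluates xi at nonempty subsequences
of s. *)
Lemma rw_density_map (tau : E -> E) s :
  (forall s', s' != [::] -> subseq s' s ->
     seqfun xi (map tau s') = seqfun xi s') ->
  rw_density (map tau s) = rw_density s.
Proof.
move: {2}(size s) (leqnn (size s)) => k.
elim: k s => [|k IH] [|x s]// sk h; rewrite [map tau _]/=.
rewrite !rw_density_cons size_map !big_seq.
apply: eq_bigr => b /size_masks sb; rewrite -!map_mask -map_cons h//; last first.
  by rewrite /= eqxx mask_subseq.
congr (_ * _)%R; apply: IH => [|s' s'0 ss].
  by rewrite size_mask ?size_map// count_map (leq_trans (count_size _ _))// sb.
apply: h => //; apply: subseq_trans ss _.
exact: subseq_trans (mask_subseq _ _) (subseq_cons _ _).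
Qed.
End reweighted.

(** * Product measures on tuples *)

Section seq_measurability.
Context d (T : measurableType d) (R : realType).
Implicit Types (F H : seq T -> \bar R).

Definition seq_measurable F :=
  forall n, measurable_fun setT (fun z : n.-tuple T => F z).

Lemma measurable_select n (l : seq 'I_n) :
  measurable_fun setT
    (fun z : n.-tuple T => [tuple of map (tnth z) (in_tuple l)] :
       (size l).-tuple T).
Proof.
apply/measurable_fun_tnthP => i /=.
have := @measurable_tnth _ T n (tnth (in_tuple l) i).
by apply: eq_measurable_fun => z _ /=; rewrite tnth_map.
Qed.

Lemma mask_tnth n (b : bitseq) (z : n.-tuple T) :
  mask b z = map (tnth z) (mask b (enum 'I_n)).
Proof. by rewrite map_mask map_tnth_enum. Qed.

Lemma seq_measurable_mask F n b : seq_measurable F ->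
  measurable_fun setT (fun z : n.-tuple T => F (mask b z)).
Proof.
move=> mF; under eq_fun do rewrite mask_tnth.
have h := (measurableT_comp (mF (size (mask b (enum 'I_n)))) (@measurable_select n
  (mask b (enum 'I_n)))).
exact h.
Qed.

Lemma seq_measurable_cons F x : seq_measurable F ->
  seq_measurable (fun s => F (x :: s)).
Proof.
move=> mF n; have mc : measurable_fun setT (fun z : n.-tuple T => [tuple of x :: z]).
  exact: measurable_cons.
exact: (measurableT_comp (mF n.+1) mc).
Qed.

Lemma seq_measurable_fun (f : forall n, n.-tuple T -> \bar R) :
  (forall n, measurable_fun setT (f n : n.-tuple T -> \bar R)) ->
  seq_measurable (seqfun f).
Proof.
move=> mf n; apply: eq_measurable_fun (mf n) => z _.
by rewrite seqfunE.
Qed.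

End seq_measurability.

Section tuple_power_integral.
Context d (T : measurableType d) (R : realType).
Variable mu : {sigma_finite_measure set T -> \bar R}.
Implicit Types (F H : seq T -> \bar R).

Definition seq_integral n F := \int[tuple_power mu n]_z F z.

(** Tonelli for the measure [sfprod], of which the measure on tuples of length n.+1 is an
image. *)
Lemma measurable_integral_cons n (f : n.+1.-tuple T -> \bar R) :
  measurable_fun setT f -> (forall z, 0 <= f z) ->
  measurable_fun setT (fun x => \int[tuple_power mu n]_z f [tuple of x :: z]).
Proof.
move=> mf f0.
have mfc : measurable_fun setT (f \o @cons_pair _ T n).
  by apply: (measurableT_comp mf); exact: measurable_cons_pair.
have := measurable_fun_fubini_tonelli_F (m2 := tuple_power mu n) _ mfc.
by apply => p; exact: f0.
Qed.

Lemma integral_tuple_powerS n (f : n.+1.-tuple T -> \bar R) :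
  measurable_fun setT f -> (forall z, 0 <= f z) ->
  \int[tuple_power mu n.+1]_z f z =
  \int[mu]_x \int[tuple_power mu n]_z f [tuple of x :: z].
Proof.
move=> mf f0.
have mfc : measurable_fun setT (f \o @cons_pair _ T n).
  by apply: (measurableT_comp mf); exact: measurable_cons_pair.
transitivity (\int[sfprod mu (tuple_power mu n)]_p (f \o @cons_pair _ T n) p).
  have := ge0_integral_pushforward (@measurable_cons_pair _ T n)
    (sfprod mu (tuple_power mu n)) measurableT mf.
  by rewrite preimage_setT; apply => z _; exact: f0.
have := fubini_tonelli1 (m1 := mu) (m2 := tuple_power mu n) _ mfc.
by apply => p; exact: f0.
Qed.

Lemma seq_integral_ge0 n F : (forall s, 0 <= F s) -> 0 <= seq_integral n F.
Proof. by move=> F0; exact: integral_ge0. Qed.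

Lemma seq_integral0 F : (forall s, 0 <= F s) -> seq_integral 0 F = F [::].
Proof.
move=> F0; rewrite /seq_integral /=.
have mF : measurable_fun setT (fun z : 0.-tuple T => F z).
  by rewrite (_ : (fun _ => _) = cst (F [::]))//; apply/funext => z; rewrite tuple0.
by rewrite integral_dirac// diracT mul1e.
Qed.

Lemma measurable_seq_integral n F : seq_measurable F -> (forall s, 0 <= F s) ->
  measurable_fun setT (fun x => seq_integral n (fun s => F (x :: s))).
Proof.
move=> mF F0.
exact: (measurable_integral_cons (f := fun z : n.+1.-tuple T => F z) (mF _) (fun z =>
  F0 z)).
Qed.

Lemma seq_integralS n F : seq_measurable F -> (forall s, 0 <= F s) ->
  seq_integral n.+1 F = \int[mu]_x seq_integral n (fun s => F (x :: s)).
Proof.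
move=> mF F0.
exact: (integral_tuple_powerS (f := fun z : n.+1.-tuple T => F z) (mF _) (fun z => F0 z)).
Qed.

(** Tonelli, one variable at a time: each variable belongs to exactly one of the two
factors. *)
Lemma seq_integral_mask n b F H : size b = n ->
  seq_measurable F -> (forall s, 0 <= F s) ->
  seq_measurable H -> (forall s, 0 <= H s) ->
  seq_integral n (fun s => F (mask b s) * H (mask (map negb b) s)) =
  seq_integral (count id b) F * seq_integral (count negb b) H.
Proof.
move=> <-{n} mF F0; elim: b F H mF F0 => [|c b IH] F H mF F0 mH H0.
  rewrite !seq_integral0//; last by move=> s; apply: mule_ge0.
have mFH : seq_measurable (fun s => F (mask (c :: b) s) *
    H (mask (map negb (c :: b)) s)).
  by move=> n; apply: emeasurable_funM; apply: seq_measurable_mask.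
rewrite seq_integralS//; last by move=> s; apply: mule_ge0.
case: c mFH => mFH /=.
- under eq_integral do rewrite (IH _ _ (seq_measurable_cons _ mF))//.
  rewrite ge0_integralZr ?seq_integral_ge0//; last first.
  + by move=> x _; exact: seq_integral_ge0.
  + exact: measurable_seq_integral.
  by rewrite -seq_integralS.
- under eq_integral do rewrite (IH _ _ mF F0 (seq_measurable_cons _ mH))//.
  rewrite ge0_integralZl ?seq_integral_ge0//; last first.
  + by move=> x _; exact: seq_integral_ge0.
  + exact: measurable_seq_integral.
  by rewrite -seq_integralS.
Qed.

End tuple_power_integral.

(** * Null sets, invariance and signed products *)

Section ae_tuple_power.
Context d (T : measurableType d) (R : realType).
Variable mu : {sigma_finite_measure set T -> \bar R}.

Lemma ae0_integral0 d' (S : measurableType d') (m : {measure set S -> \bar R})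
    (f : S -> \bar R) : measurable_fun setT f -> (forall x, 0 <= f x) ->
  \int[m]_x f x = 0 -> \forall x \ae m, f x = 0.
Proof.
move=> mf f0 If; have /ae_eq_integral_abs : measurable_fun setT f by [].
move=> /(_ m measurableT)[+ _]; under eq_integral do rewrite gee0_abs//.
by move=> /(_ If); apply: filterS => x /(_ I).
Qed.

Lemma ae_lty_integral d' (S : measurableType d') (m : {measure set S -> \bar R})
    (f : S -> \bar R) : measurable_fun setT f -> (forall x, 0 <= f x) ->
  \int[m]_x f x < +oo -> \forall x \ae m, f x < +oo.
Proof.
move=> mf f0 If; have fi : m.-integrable setT f.
  by apply/integrableP; split => //; under eq_integral do rewrite gee0_abs//.
have := integrable_ae measurableT fi.
by apply: filterS => x /(_ I); rewrite ge0_fin_numE.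
Qed.

(** Tonelli for the indicator of a measurable null set containing the exceptional points. *)
Lemma ae_tuple_cons n (Q : n.+1.-tuple T -> Prop) :
  (\forall z \ae tuple_power mu n.+1, Q z) ->
  \forall x \ae mu, {ae tuple_power mu n, forall z : n.-tuple T, Q [tuple of x :: z]}.
Proof.
case=> N [mN N0 QN].
have mI : measurable_fun setT (fun z => (\1_N z)%:E : \bar R).
  by apply/measurable_EFinP; exact: measurable_indic.
have I0 z : 0 <= (\1_N z)%:E :> \bar R by rewrite lee_fin.
have : \int[mu]_x \int[tuple_power mu n]_z (\1_N [tuple of x :: z])%:E = 0.
  by rewrite -(integral_tuple_powerS mu mI I0) integral_indic// setIT.
move/(ae0_integral0 (measurable_integral_cons mu mI I0)).
move=> /(_ (fun x => integral_ge0 _ (fun z _ => I0 _))).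
apply: filterS => x.
have mc : measurable_fun setT (fun z : n.-tuple T => [tuple of x :: z]).
  exact: measurable_cons.
have mIx := measurableT_comp mI mc.
move/(ae0_integral0 mIx) => /(_ (fun z => I0 _)).
apply: filterS => z [/eqP]; rewrite indicE pnatr_eq0 eqb0 notin_setE => nN.
by apply: contrapT => nQ; apply: nN; exact: QN.
Qed.

(** [seq_integral_mask] with F the indicator of a null set and H = 1: the tuples whose
selected part is exceptional have measure 0 times a possibly infinite factor, which is 0. *)
Lemma ae_seq_mask n b (Q : seq T -> Prop) : size b = n ->
  ({ae tuple_power mu (count id b), forall z : (count id b).-tuple T, Q z}) ->
  {ae tuple_power mu n, forall z : n.-tuple T, Q (mask b z)}.
Proof.
move=> sb [N [mN N0 QN]].
(* the indicator of N on sequences of the length selected by b, and 0 at other lengths *)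
pose f k (z : k.-tuple T) : \bar R :=
  if eqVneq (count id b) k is EqNotNeq e then
    (\1_N (tcast (esym e) z))%:E else 0.
have f0 k z : 0 <= @f k z.
  by rewrite /f; case: eqVneq => [e|//]; rewrite lee_fin.
have mf k : measurable_fun setT (@f k : k.-tuple T -> \bar R).
  rewrite /f; case: eqVneq => [e|_]; last exact: measurable_cst.
  case: _ / e => /=; apply: eq_measurable_fun (_ : measurable_fun setT (fun z =>
    (\1_N z)%:E : \bar R)).
    by move=> z _.
  by apply/measurable_EFinP; exact: measurable_indic.
have fE (z : (count id b).-tuple T) : seqfun f z = (\1_N z)%:E.
  rewrite seqfunE /f; case: eqVneq => [e|/eqP//].
  by rewrite (eq_irrelevance e erefl).
have mF := seq_measurable_fun mf.
have F0 s : 0 <= seqfun f s by exact: f0.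
have m1 : seq_measurable (fun _ : seq T => 1 : \bar R).
  by move=> k; exact: measurable_cst.
have := @seq_integral_mask _ T R mu n b (seqfun f) (fun=> 1) sb mF F0 m1 (fun _ => lee01).
have -> : seq_integral mu (count id b) (seqfun f) = 0.
  rewrite /seq_integral; under eq_integral do rewrite fE.
  by rewrite integral_indic// setIT.
rewrite mul0e /seq_integral; under eq_integral do rewrite mule1.
have mFm := @seq_measurable_mask _ T R (seqfun f) n b mF.
move/(ae0_integral0 mFm (fun=> F0 _)).
apply: filterS => z.
have szb : size (mask b z) = count id b by rewrite size_mask// sb size_tuple.
have -> : mask b z = tcast szb (in_tuple (mask b z)) by rewrite val_tcast.
rewrite fE => -[/eqP]; rewrite indicE pnatr_eq0 eqb0 notin_setE => nN.
by apply: contrapT => nQ; apply: nN; exact: QN.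
Qed.

(** There are only countably many masks. *)
Lemma ae_subseq (Q : seq T -> Prop) :
  (forall k, (0 < k)%N -> {ae tuple_power mu k, forall z : k.-tuple T, Q z}) ->
  forall n, {ae tuple_power mu n, forall z : n.-tuple T,
    forall s', s' != [::] -> subseq s' z -> Q s'}.
Proof.
move=> aeQ n.
pose dec i : bitseq := odflt [::] (unpickle i).
have : {ae tuple_power mu n, forall z : n.-tuple T, forall i,
    size (dec i) = n -> (0 < count id (dec i))%N -> Q (mask (dec i) z)}.
  apply/ae_foralln => i.
  have [sb|/eqP nsb] := eqVneq (size (dec i)) n; last by apply: aeW => z sb; case: (nsb sb).
  have [c0|/negP nc0] := boolP (0 < count id (dec i))%N; last by apply: aeW => z _.
  by have := ae_seq_mask sb (aeQ _ c0); apply: filterS.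
apply: filterS => z h s' s'0 /subseqP[b sb s'E].
have := h (pickle b); rewrite /dec pickleK/= sb size_tuple => /(_ erefl).
rewrite s'E; apply; rewrite -(size_mask sb) -s'E.
by case: s' s'0 {s'E}.
Qed.
End ae_tuple_power.

Section tuple_power_invariance.
Context d (T : measurableType d) (R : realType).
Variable mu : {sigma_finite_measure set T -> \bar R}.

(** Invariance is stated through integrals of nonnegative functions because only these pass
through Tonelli from one coordinate to all. *)
Definition integral_invariant (tau : T -> T) :=
  measurable_fun setT tau /\
  forall f : T -> \bar R, measurable_fun setT f -> (forall x, 0 <= f x) ->
  \int[mu]_x f (tau x) = \int[mu]_x f x.

(** Each position has its own map, so that translating a vector, which shifts every
coordinate by a different amount, is an instance. *)
Fixpoint mapi (tau : nat -> T -> T) (s : seq T) : seq T :=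
  if s is x :: s' then tau 0%N x :: mapi (fun i => tau i.+1) s' else [::].

Lemma size_mapi tau s : size (mapi tau s) = size s.
Proof. by elim: s tau => //= x s IH tau; rewrite IH. Qed.

Lemma nth_mapi x0 tau s i : (i < size s)%N ->
  nth x0 (mapi tau s) i = tau i (nth x0 s i).
Proof. by elim: s tau i => //= x s IH tau [|i]//; exact: IH. Qed.

Lemma mapi_map tau s : mapi (fun=> tau) s = map tau s.
Proof. by elim: s => //= x s ->. Qed.

Lemma mapi_tupleP n tau (z : n.-tuple T) : size (mapi tau z) == n.
Proof. by rewrite size_mapi size_tuple. Qed.

Lemma seq_measurable_mapi tau F : (forall i, measurable_fun setT (tau i)) ->
  seq_measurable F -> seq_measurable (fun s => F (mapi tau s) : \bar R).
Proof.
move=> mtau mF n.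
have mt : measurable_fun setT (fun z : n.-tuple T => Tuple (mapi_tupleP tau z)).
  apply/measurable_fun_tnthP => i.
  have := measurableT_comp (mtau i) (@measurable_tnth _ T n i).
  apply: eq_measurable_fun => z _ /=.
  by have x0 := tnth z i; rewrite !(tnth_nth x0) /= nth_mapi// size_tuple.
by have h := measurableT_comp (mF n) mt; exact h.
Qed.

Lemma seq_integral_mapi tau n F : (forall i, integral_invariant (tau i)) ->
  seq_measurable F -> (forall s, 0 <= F s) ->
  seq_integral mu n (fun s => F (mapi tau s)) = seq_integral mu n F.
Proof.
move=> itau mF F0; elim: n tau F itau mF F0 => [|n IH] tau F itau mF F0.
  by rewrite !seq_integral0.
have mtau i : measurable_fun setT (tau i) by case: (itau i).
rewrite !seq_integralS//; last exact: seq_measurable_mapi.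
rewrite -[RHS](itau 0%N).2; last 2 first.
- exact: measurable_seq_integral.
- by move=> x; exact: seq_integral_ge0.
apply: eq_integral => x _ /=.
rewrite (IH (fun i => tau i.+1) (fun s => F (tau 0%N x :: s)))//.
exact: seq_measurable_cons.
Qed.

Lemma seq_integral_map tau n F : integral_invariant tau -> seq_measurable F ->
  seq_integral mu n (fun s => F (map tau s)) = seq_integral mu n F.
Proof.
move=> itau mF; rewrite /seq_integral [in LHS]integralE [in RHS]integralE.
have mFp : seq_measurable (fun s => maxe (F s) 0).
  by move=> k; apply: measurable_maxe => //; exact: mF.
have mFn : seq_measurable (fun s => maxe (- F s) 0).
  move=> k; apply: measurable_maxe => //; by apply: measurableT_comp => //; exact: mF.
have F0 (G : seq T -> \bar R) s : 0 <= maxe (G s) 0 by rewrite le_max lexx orbT.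
have emap (G : seq T -> \bar R) : (fun s => G (mapi (fun=> tau) s)) = G \o map tau.
  by apply/funext => s; rewrite mapi_map.
have ep : seq_integral mu n ((fun s => maxe (F s) 0) \o map tau) =
    seq_integral mu n (fun s => maxe (F s) 0).
  by rewrite -emap; exact: seq_integral_mapi.
have en : seq_integral mu n ((fun s => maxe (- F s) 0) \o map tau) =
    seq_integral mu n (fun s => maxe (- F s) 0).
  by rewrite -emap; apply: seq_integral_mapi => //; exact: (F0 (fun s => - F s)).
congr (_ - _).
- transitivity (seq_integral mu n ((fun s => maxe (F s) 0) \o map tau)).
    by apply: eq_integral => z _; rewrite funeposE.
  by rewrite ep; apply: eq_integral => z _; rewrite funeposE.
- transitivity (seq_integral mu n ((fun s => maxe (- F s) 0) \o map tau)).
    by apply: eq_integral => z _; rewrite funenegE.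
  by rewrite en; apply: eq_integral => z _; rewrite funenegE.
Qed.

(** H being nonnegative, the positive and negative parts of the product are those of F times
H, and [seq_integral_mask] applies to each. *)
Lemma seq_integral_maskr n b (F H : seq T -> R) : size b = n ->
  seq_measurable (EFin \o F) -> seq_measurable (EFin \o H) ->
  (forall s, (0 <= H s)%R) ->
  seq_integral mu (count id b) (fun s => `|F s|%:E) < +oo ->
  seq_integral mu (count negb b) (EFin \o H) < +oo ->
  seq_integral mu n (fun s => (F (mask b s) * H (mask (map negb b) s))%:E) =
  seq_integral mu (count id b) (EFin \o F) * seq_integral mu (count negb b) (EFin \o H).
Proof.
move=> sb mF mH H0 Foo Hoo.
have HE0 s : 0 <= (EFin \o H) s by rewrite lee_fin.
have mFr k : measurable_fun setT (fun z : k.-tuple T => F z).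
  by apply/measurable_EFinP; exact: mF.
have mFp : seq_measurable (fun s => (Num.max (F s) 0)%:E).
  by move=> k; apply/measurable_EFinP; have h :=
    measurable_maxr (mFr k) (@measurable_cst _ _ _ _ setT (0%R : R)); exact h.
have mFn : seq_measurable (fun s => (Num.max (- F s) 0)%:E).
  move=> k; apply/measurable_EFinP.
  have mNF : measurable_fun setT (fun z : k.-tuple T => - F z)%R by have h :=
    measurableT_comp (@oppr_measurable R setT) (mFr k); exact h.
  by have h := measurable_maxr mNF (@measurable_cst _ _ _ _ setT (0%R : R)); exact h.
have mFa : seq_measurable (fun s => `|F s|%:E).
  move=> k; apply/measurable_EFinP.
  by have h := measurableT_comp (@normr_measurable R setT) (mFr k); exact h.
have F0 (G : seq T -> R) s : 0 <= (Num.max (G s) 0)%:E by rewrite lee_fin le_max lexx orbT.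
have Foo' (G : seq T -> R) : (forall s, `|G s| = `|F s|)%R ->
   seq_measurable (fun s => (Num.max (G s) 0)%:E) ->
   seq_integral mu (count id b) (fun s => (Num.max (G s) 0)%:E) < +oo.
  move=> GF mG; apply: le_lt_trans Foo; apply: ge0_le_integral.
  - by [].
  - by move=> z _; exact: F0.
  - exact: mG.
  - exact: mFa.
  - by move=> z _; rewrite lee_fin -GF ge_max ler_norm normr_ge0.
have ip := @seq_integral_mask _ T R mu n b _ _ sb mFp (F0 F) mH HE0.
have im := @seq_integral_mask _ T R mu n b _ _ sb mFn (F0 (fun s => - F s)%R) mH HE0.
have ip0 := seq_integral_ge0 mu (count id b) (F0 F).
have im0 := seq_integral_ge0 mu (count id b) (F0 (fun s => - F s)%R).
have ipoo := Foo' F (fun=> erefl) mFp.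
have imoo := Foo' (fun s => - F s)%R (fun s => normrN _) mFn.
rewrite {1}/seq_integral integralE.
rewrite [X in _ = X * _]/seq_integral [X in _ = X * _]integralE.
rewrite (_ : \int[_]_x _ = seq_integral mu n (fun s =>
    (Num.max (F (mask b s)) 0)%:E * (EFin \o H) (mask (map negb b) s))); last first.
  apply: eq_integral => z _; rewrite funeposE /= -EFinM -EFin_max; congr EFin.
  by rewrite maxr_pMl// mul0r.
rewrite (_ : \int[_]_x ((fun _ => _)^\- x) = seq_integral mu n (fun s =>
    (Num.max (- F (mask b s)) 0)%:E * (EFin \o H) (mask (map negb b) s))); last first.
  apply: eq_integral => z _; rewrite funenegE /= -EFinM -EFin_max; congr EFin.
  by rewrite -mulNr maxr_pMl// mul0r.
rewrite ip im.
have -> : \int[tuple_power mu (count id b)]_x ((fun x => (EFin \o F) (val x))^\+ x)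
  = seq_integral mu (count id b) (fun s => (Num.max (F s) 0)%:E).
  by apply: eq_integral => z _; rewrite funeposE /= -EFin_max.
have -> : \int[tuple_power mu (count id b)]_x ((fun x => (EFin \o F) (val x))^\- x)
  = seq_integral mu (count id b) (fun s => (Num.max (- F s) 0)%:E).
  by apply: eq_integral => z _; rewrite funenegE /= -EFin_max.
have := seq_integral_ge0 mu (count negb b) HE0.
move: ip0 im0 ipoo imoo Hoo; clear.
case: (seq_integral _ _ _) => [x| |]//; case: (seq_integral _ _ _) => [y| |]//.
case: (seq_integral _ _ _) => [z| |]// _ _ _ _ _ _.
by apply: (congr1 EFin); rewrite mulrBl.
Qed.
End tuple_power_invariance.

(** * Translations of space-time *)

Section lebesgue_invariance.
Context (R : realType).

Lemma pushforward_shift_lebesgue (c : R) (A : set R) : measurable A ->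
  lebesgue_line ((fun x : R => x + c)%R @^-1` A) = lebesgue_line A.
Proof.
move=> mA; have ms : measurable_fun setT (fun x : measurableTypeR R => (x
  + c)%R : measurableTypeR R).
  exact: measurable_funD.
pose mnu := measure_function_pushforward__canonical__measure_function_Measure
  (@lebesgue_measure R) ms.
transitivity (mnu A); first by [].
apply/esym/lebesgue_measure_unique => // X [[a b] /= ab <-].
rewrite lebesgue_measure_itv/= /pushforward.
rewrite (_ : _ @^-1` _ = `](a - c)%R, (b - c)%R]%classic); last first.
  by apply/seteqP; split => x /=; rewrite !in_itv/= ltrBlDr lerBrDr.
rewrite lebesgue_measure_itv/= !lte_fin ltrD2r; case: ifPn => // _.
by rewrite -!EFinB; congr EFin; rewrite opprB addrA subrK.
Qed.

Lemma shift_invariant (c : R) :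
  integral_invariant (@lebesgue_line R) (fun x => x + c)%R.
Proof.
have ms : measurable_fun setT (fun x : R => x + c)%R by exact: measurable_funD.
split => // f mf f0.
have := ge0_integral_pushforward ms (@lebesgue_line R) measurableT mf.
rewrite preimage_setT => <-; last by move=> x _; exact: f0.
by apply: eq_measure_integral => A mA _; exact: pushforward_shift_lebesgue.
Qed.

Context (d : nat).
Local Notation E := (spacetime R d).

Lemma measurable_translate (c : E) : measurable_fun setT (translate c).
Proof.
apply/measurable_fun_pair => /=.
  apply/measurable_fun_tnthP => i.
  have m1 : measurable_fun setT (fun y : E => tnth y.1 i).
    by have h := measurableT_comp (@measurable_tnth _ R d i) (@measurable_fst _ _
      (d.-tuple R) R); exact h.
  have h := measurable_funD m1 (@measurable_cst _ _ _ _ setT (tnth c.1 i)).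
  by apply: eq_measurable_fun h => y _ /=; rewrite tnth_mktuple.
by apply: measurable_funD => //; exact: measurable_snd.
Qed.

(** Tonelli in space and time reduces this to shifts of the line, coordinate by coordinate. *)
Lemma translate_invariant (c : E) :
  integral_invariant (lebesgue_spacetime R d) (translate c).
Proof.
split=> [|f mf f0]; first exact: measurable_translate.
have mfc : measurable_fun setT (f \o translate c).
  by have h := measurableT_comp mf (measurable_translate c); exact h.
have := fubini_tonelli2 (m1 := tuple_power (@lebesgue_line R) d)
   (m2 := @lebesgue_line R) _ mf f0.
have := fubini_tonelli2 (m1 := tuple_power (@lebesgue_line R) d)
   (m2 := @lebesgue_line R) _ mfc (fun _ => f0 _).
rewrite /lebesgue_spacetime /= /sfprod => -> ->.
rewrite /fubini_G -[RHS](shift_invariant c.2).2; last 2 first.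
- exact: (measurable_fun_fubini_tonelli_G (m1 := tuple_power (@lebesgue_line R) d)).
- by move=> y; apply: integral_ge0.
apply: eq_integral => y _ /=.
(* the default 0 is only read on sequences shorter than d, where any value will do *)
pose G (s : seq R) := f ([tuple nth 0%R s i | i < d], y + c.2)%R.
have mG : seq_measurable G.
  move=> n; apply: measurableT_comp mf _; apply/measurable_fun_pair => //=.
  apply/measurable_fun_tnthP => i.
  have [ni|ni] := ltnP i n; last first.
    apply: eq_measurable_fun (@measurable_cst _ _ _ _ setT (0%R : R)) => z _ /=.
    by rewrite tnth_mktuple nth_default// size_tuple.
  apply: eq_measurable_fun (@measurable_tnth _ R n (Ordinal ni)) => z _ /=.
  by rewrite tnth_mktuple (tnth_nth 0%R).
have := @seq_integral_mapi _ R R (@lebesgue_line R)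
  (fun i x => x + nth 0 c.1 i)%R d G (fun i => shift_invariant _) mG (fun s => f0 _).
have GE (z : d.-tuple R) : G z = f (z, y + c.2)%R.
  by congr (f (_, _)); apply: eq_from_tnth => i; rewrite tnth_mktuple (tnth_nth 0%R).
rewrite /seq_integral.
under [X in _ = X -> _]eq_integral do rewrite GE.
move=> <-; apply: eq_integral => z _; congr (f (_, _)).
apply: eq_from_tnth => i; rewrite !tnth_mktuple nth_mapi ?size_tuple//.
by rewrite !(tnth_nth 0%R).
Qed.

End lebesgue_invariance.

(** * Windows *)

Section windows.
Context (R : realType) (d : nat).
Local Notation E := (spacetime R d).
Implicit Types (a u y : E) (r t : R).

Definition window r t a : set E :=
  [set u : E | (enorm [tuple (tnth a.1 i - tnth u.1 i)%R | i < d] <= r)%R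
               /\ (`|a.2 - u.2| <= t)%R].

Lemma window_translate r t a y : window r t a (translate a y) <-> cyl r t y.
Proof.
rewrite /window /cyl /translate /=.
have -> : enorm [tuple (tnth a.1 i - tnth [tuple (tnth y.1 i0
  + tnth a.1 i0)%R | i0 < d] i)%R | i < d]
   = enorm y.1 :> R.
  congr Num.sqrt; apply: eq_bigr => i _; rewrite !tnth_mktuple.
  by rewrite opprD addrCA subrr addr0 sqrrN.
by rewrite opprD addrCA subrr addr0 normrN.
Qed.

Lemma translate_origin a : translate a (origin R d) = a.
Proof.
case: a => v s; rewrite /translate /origin /= add0r; congr pair.
by apply: eq_from_tnth => i; rewrite !tnth_mktuple add0r.
Qed.

(** The crude bound |u|^2 <= 2 |a|^2 + 2 |a - u|^2 is enough: all windows centred in a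
bounded set lie in one cylinder. *)
Lemma window_bounded (N M r t : R) a :
  (0 <= N)%R -> (0 <= r)%R -> cyl N M a ->
  window r t a `<=` cyl (Num.sqrt (2 * (N ^+ 2 + r ^+ 2))) (M + t).
Proof.
move=> N0 r0 [aN aM] u [ur ut]; split; last first.
  have -> : u.2 = (a.2 - (a.2 - u.2))%R by rewrite subKr.
  by rewrite (le_trans (ler_normB _ _))// lerD.
have sq (v : d.-tuple R) (q : R) : (0 <= q)%R -> (enorm v <= q)%R ->
    (\sum_(i < d) tnth v i ^+ 2 <= q ^+ 2)%R.
  move=> q0 vq; rewrite -[leLHS]sqr_sqrtr; last by apply: sumr_ge0 => i _; exact: sqr_ge0.
  by rewrite ler_pXn2r// nnegrE// sqrtr_ge0.
rewrite /enorm ler_wsqrtr// mulrDr.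
apply: (le_trans (_ : _ <= \sum_(i < d) (2 * tnth a.1 i ^+ 2 +
    2 * (tnth a.1 i - tnth u.1 i) ^+ 2))%R).
  apply: ler_sum => i _; move: (tnth a.1 i) (tnth u.1 i) => x y.
  rewrite -subr_ge0 (_ : _ - _ = (2 * x - y) ^+ 2)%R ?sqr_ge0//.
  by rewrite !expr2; ring.
rewrite big_split -!mulr_sumr/= lerD// ler_wpM2l//; first exact: sq.
have := sq _ _ r0 ur; apply: le_trans; apply: ler_sum => i _.
by rewrite tnth_mktuple.
Qed.

Lemma cyl_cover a : exists n : nat, cyl (n%:R : R) n%:R a.
Proof.
exists (Num.truncn (Num.max (enorm a.1) `|a.2|)%R).+1.
by split; apply: le_trans (ltW (truncnS_gt _)); rewrite le_max lexx ?orbT.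
Qed.

Lemma window_point_bounded r t a : (0 <= r)%R -> point_bounded (window r t a).
Proof.
move=> r0; have [n na] := cyl_cover a.
by exists (Num.sqrt (2 * (n%:R ^+ 2 + r ^+ 2))), (n%:R + t)%R; exact: window_bounded.
Qed.

Lemma measurable_enorm d' (T : measurableType d') (f : T -> d.-tuple R) :
  (forall i, measurable_fun setT (fun x => tnth (f x) i)) ->
  measurable_fun setT (fun x => enorm (f x)).
Proof.
move=> mf; apply: (@measurableT_comp _ _ _ _ _ _ (@Num.sqrt R)).
  exact: continuous_measurable_fun (@sqrt_continuous R).
by apply: measurable_sum => i; exact: measurable_funX.
Qed.

Lemma measurable_coord (i : 'I_d) : measurable_fun setT (fun y : E => tnth y.1 i).
Proof.
by have h := measurableT_comp (@measurable_tnth _ R d i) (@measurable_fst _ _ (d.-tuple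
  R) R);
  exact h.
Qed.

Lemma measurable_cyl r t : measurable (cyl r t : set E).
Proof.
have m1 : measurable_fun setT (fun y : E => enorm y.1).
  by apply: measurable_enorm => i; exact: measurable_coord.
have m2 : measurable_fun setT (fun y : E => `|y.2|%R).
  exact: measurableT_comp.
have -> : (cyl r t : set E) = (fun y : E => enorm y.1) @^-1` `]-oo, r] `&`
    (fun y : E => `|y.2|%R) @^-1` `]-oo, t].
  by apply/seteqP; split => y /=; rewrite !in_itv/=.
apply: measurableI; rewrite -[X in measurable X]setTI.
  by apply: m1 => //; exact: measurable_itv.
by apply: m2 => //; exact: measurable_itv.
Qed.

Lemma measurable_window_graph r t : measurable [set p : E * E | window r t p.1 p.2].
Proof.
pose f1 (p : E * E) := enorm [tuple (tnth p.1.1 i - tnth p.2.1 i)%R | i < d].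
pose f2 (p : E * E) := `|p.1.2 - p.2.2|%R.
have m1 : measurable_fun setT f1.
  apply: measurable_enorm => i; under eq_fun do rewrite tnth_mktuple.
  apply: measurable_funB.
    by have h := measurableT_comp (measurable_coord i) (@measurable_fst _ _ E E); exact h.
  by have h := measurableT_comp (measurable_coord i) (@measurable_snd _ _ E E); exact h.
have m2 : measurable_fun setT f2.
  apply: (@measurableT_comp _ _ _ _ _ _ (@Num.norm R R)) => //; apply: measurable_funB.
    by have h := measurableT_comp (@measurable_snd _ _ (d.-tuple R) R) (@measurable_fst
      _ _ E E); exact h.
  by have h := measurableT_comp (@measurable_snd _ _ (d.-tuple R) R) (@measurable_snd _
    _ E E); exact h.
have -> : [set p : E * E | window r t p.1 p.2] = f1 @^-1` `]-oo, r] `&` f2 @^-1` `]-oo, t].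
  by apply/seteqP; split => p /=; rewrite !in_itv/=.
apply: measurableI; rewrite -[X in measurable X]setTI.
  by apply: m1 => //; exact: measurable_itv.
by apply: m2 => //; exact: measurable_itv.
Qed.

Lemma measurable_window r t a : measurable (window r t a).
Proof.
have mp : measurable_fun setT (fun u : E => (a, u)) by exact: measurable_pair1.
by have := mp measurableT _ (measurable_window_graph r t); rewrite setTI.
Qed.

End windows.

(** * Configurations are sums of atoms *)

Section atoms.
Context (R : realType) (d : nat).
Local Notation E := (spacetime R d).
Implicit Types (phi : config R d) (y : E) (A B : set E).

(** A countable family of measurable sets that separates points; one index k encodes a
coordinate and a rational bound. *)
Definition half_space (k : nat) : set E :=
  match unpickle k : option (option 'I_d * rat) with
  | Some (Some i, q) => [set y | (tnth y.1 i <= ratr q)%R]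
  | Some (None, q) => [set y | (y.2 <= ratr q)%R]
  | None => set0
  end.

Lemma measurable_half_space k : measurable (half_space k).
Proof.
rewrite /half_space; case: unpickle => [[[i|] q]|]//.
- rewrite (_ : [set y | _] = setT `&` (fun y : E => tnth y.1 i) @^-1` `]-oo, (ratr q : R)]).
    exact: (measurable_coord i measurableT (measurable_itv _)).
  by apply/seteqP; split => y /=; rewrite in_itv/= => -[].
- rewrite (_ : [set y | _] = setT `&` (@snd (d.-tuple R) R) @^-1` `]-oo, (ratr q : R)]).
    exact: (@measurable_snd _ _ (d.-tuple R) R measurableT _ (measurable_itv _)).
  by apply/seteqP; split => y /=; rewrite in_itv/= => -[].
Qed.

Lemma half_space_separates y z :
  (forall k, half_space k y <-> half_space k z) -> y = z.
Proof.
have key (a b : R) : (forall q : rat, (a <= ratr q)%R <-> (b <= ratr q)%R) -> a = b.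
  move=> h; apply/eqP; rewrite eq_le; apply/andP; split; rewrite leNgt; apply/negP.
    move/rat_in_itvoo => [q]; rewrite in_itv/= => /andP[bq qa].
    by have := (h q).2 (ltW bq); rewrite leNgt qa.
  move/rat_in_itvoo => [q]; rewrite in_itv/= => /andP[aq qb].
  by have := (h q).1 (ltW aq); rewrite leNgt qb.
case: y => v s; case: z => w u h; congr pair.
  apply: eq_from_tnth => i; apply: key => q.
  by have := h (pickle (Some i, q)); rewrite /half_space pickleK.
apply: key => q.
by have := h (pickle (None : option 'I_d, q)); rewrite /half_space pickleK.
Qed.

Lemma config_ge1 phi A : measurable A -> phi A != 0 -> 1 <= phi A.
Proof.
move=> mA; have [->|[n ->]] := config_counting phi mA; first by rewrite leey.
by rewrite eqe pnatr_eq0 -lt0n lee_fin ler1n.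
Qed.

(** Bisection: at step m keep the side of the m-th half-space that still carries mass. *)
Fixpoint nested phi B (n : nat) : set E :=
  if n is m.+1 then
    let A := nested phi B m `&` half_space m in
    if phi A != 0 then A else nested phi B m `\` half_space m
  else B.

(** Masses are integers, so the nested sets keep mass at least 1, and so does their
intersection. No half-space separates two of its points, hence it is a single point. *)
Lemma exists_atom phi B : measurable B -> phi B < +oo -> phi B != 0 ->
  exists2 y, B y & points phi y.
Proof.
move=> mB Boo B0; pose N := nested phi B.
have NS n : N n.+1 = if phi (N n `&` half_space n) != 0
    then N n `&` half_space n else N n `\` half_space n by [].
have mN n : measurable (N n).
  elim: n => // n IH; have mH := measurable_half_space n; rewrite NS.
  by case: ifP => _; [exact: measurableI|exact: measurableD].
have N0 n : phi (N n) != 0.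
  elim: n => // n IH; have mH := measurable_half_space n; rewrite NS.
  case: ifPn => // /negPn/eqP A0; move: IH.
  have -> // : phi (N n) = phi (N n `\` half_space n).
  rewrite -[RHS]adde0 -A0; exact: measureDI.
have dN : nonincreasing_seq N.
  apply/nonincreasing_seqP => n; apply/subsetPset; rewrite NS.
  by case: ifP => _ y [].
have mcap : measurable (\bigcap_n N n) by exact: bigcapT_measurable.
have := nonincreasing_cvg_mu (mu := phi) Boo mN mcap dN.
move=> cvgN; have cap1 : 1 <= phi (\bigcap_n N n).
  rewrite -(cvg_lim _ cvgN)//; apply: lime_ge; first exact: cvgP cvgN.
  by apply: nearW => n; exact: config_ge1.
have [y yN] : exists y, (\bigcap_n N n) y.
  apply/set0P/eqP => N0'; move: cap1; rewrite N0' measure0.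
  by rewrite lee_fin ler10.
have side n z : (\bigcap_n N n) z -> half_space n z <-> phi (N n `&` half_space n) != 0.
  move=> /(_ n.+1 I); rewrite NS; case: ifP => [h [_ Hz]|h [_ Hz]]; by split.
have capE : \bigcap_n N n = [set y].
  apply/seteqP; split => [z zN /=|_ -> //].
  by apply: half_space_separates => k; rewrite (side k _ zN) (side k _ yN).
exists y; first exact: (yN 0%N I).
rewrite /points /= -capE; apply: contraTneq cap1 => ->.
by rewrite lee_fin ler10.
Qed.

Lemma size_le_config phi B (s : seq E) : measurable B -> uniq s ->
  (forall y, y \in s -> B y /\ points phi y) -> (size s)%:R%:E <= phi B.
Proof.
move=> + + sB; elim: s B sB => [|y s IH] B sB mB; first by rewrite measure_ge0.
move=> /= /andP[ys us]; have my := @measurable_point1 _ _ y.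
have [By py] := sB y (mem_head _ _).
rewrite (measureDI phi mB my) -natr1 EFinD; apply: leeD.
  apply: IH => // [z zs|]; last exact: measurableD.
  have [|Bz pz] := sB z; first by rewrite inE zs orbT.
  by split => //; split => // zy; move: ys; rewrite -zy zs.
have -> : B `&` [set y] = [set y] by apply/seteqP; split => [z []|z ->].
exact: config_ge1.
Qed.

Lemma points_finite phi B : measurable B -> phi B < +oo ->
  finite_set (points phi `&` B).
Proof.
move=> mB; have [->//|[n Bn _]] := config_counting phi mB.
apply: contrapT => /(infinite_set_fset n.+1)[F FB nF].
have := @size_le_config phi B (finmap.enum_fset F) mB (finmap.fset_uniq F).
have FBs y : y \in finmap.enum_fset F -> B y /\ points phi y by move=> /FB[].
move=> /(_ FBs); rewrite Bn lee_fin ler_nat leqNgt.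
by rewrite (leq_trans _ nF).
Qed.

Lemma points_cover phi : points phi = \bigcup_n (points phi `&` cyl n%:R n%:R).
Proof.
apply/seteqP; split => [y py|y [n _ []]//].
by have [n ny] := cyl_cover y; exists n.
Qed.

Lemma cyl_config_lty phi (r t : R) : phi (cyl r t) < +oo.
Proof.
by apply: config_locally_finite; [exact: measurable_cyl|exists r, t].
Qed.

Lemma points_countable phi : countable (points phi).
Proof.
rewrite points_cover; apply: bigcup_countable => // n _.
apply: finite_set_countable; apply: points_finite; first exact: measurable_cyl.
exact: cyl_config_lty.
Qed.

Lemma measurable_points phi : measurable (points phi).
Proof.
apply: countable_measurable; first exact: measurable_point1.
exact: points_countable.
Qed.

(** Otherwise the part of the complement in some cylinder would carry mass and contain an
atom. *)
Lemma config_no_diffuse phi : phi (~` points phi) = 0.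
Proof.
have mP := measurableC (measurable_points phi).
have -> : ~` points phi = \bigcup_n (~` points phi `&` cyl n%:R n%:R).
  apply/seteqP; split => [y py|y [n _ []]//].
  by have [n ny] := cyl_cover y; exists n.
have mC n : measurable (~` points phi `&` cyl n%:R n%:R).
  by apply: measurableI => //; exact: measurable_cyl.
have nul n : phi (~` points phi `&` cyl n%:R n%:R) = 0.
  apply/eqP/negPn/negP => c0.
  have [|y [+ _] py] := exists_atom (mC n) _ c0; last by move/(_ py).
  apply: le_lt_trans (cyl_config_lty phi n%:R n%:R).
  by apply: le_measure; rewrite ?inE//; exact: measurable_cyl.
apply/(negligibleP phi); first exact: bigcupT_measurable.
apply: negligible_bigcup => n; apply/(negligibleP phi) => //; exact: nul.
Qed.

(** A configuration is carried by its countably many atoms, which have mass exactly 1 when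
it is simple. *)
Lemma integral_config phi (f : E -> \bar R) : simple_config phi ->
  measurable_fun setT f -> (forall y, 0 <= f y) ->
  \int[phi]_y f y = \esum_(y in points phi) f y.
Proof.
move=> sphi mf f0; have mP := measurable_points phi.
have /countable_injP[g ginj] := points_countable phi.
pose F n := [set y | points phi y /\ g y = n].
have F1 n : F n = set0 \/ exists2 y, points phi y & F n = [set y].
  have [->|/set0P[y [py gy]]] := eqVneq (F n) set0; first by left.
  right; exists y => //; apply/seteqP; split => [z [pz gz]|z ->//].
  by apply: ginj; rewrite ?inE// gz gy.
have UF : \bigcup_n F n = points phi.
  by apply/seteqP; split => [y [n _ []]//|y py]; exists (g y).
have tF : trivIset setT F by move=> i j _ _ [y [[_ <-] [_ <-]]].
have mF n : measurable (F n).
  by have [->|[y _ ->]] := F1 n => //; exact: measurable_point1.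
have -> : \int[phi]_y f y = \int[phi]_(y in points phi) f y.
  rewrite (ge0_negligible_integral (N := ~` points phi))//.
  - by rewrite setTD setCK.
  - exact: measurableC.
  - exact: config_no_diffuse.
rewrite -{1}UF ge0_integral_bigcup//; last exact: measurable_funTS.
rewrite nneseries_esumT; last by move=> n; exact: integral_ge0.
rewrite -UF esum_bigcupT//; apply: eq_esum => n _.
have [->|[y py ->]] := F1 n; first by rewrite integral_set0 esum_set0.
rewrite esum_set1// (eq_integral (cst (f y))); last first.
  by move=> z; rewrite inE => ->.
rewrite integral_cst; last exact: measurable_point1.
suff -> : phi [set y] = 1 by rewrite mule1.
apply/eqP; rewrite eq_le sphi/=; apply: config_ge1 => //.
exact: measurable_point1.
Qed.
End atoms.

(** * Measurability of sums over points *)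

Section config_kernel.
Context (R : realType) (d : nat).
Local Notation E := (spacetime R d).

Lemma measurable_config_eval (A : set E) : measurable A ->
  measurable_fun setT (fun phi : config R d => phi A).
Proof.
move=> mA _ B mB; apply: sub_sigma_algebra.
by exists A => //; exists B.
Qed.

Lemma measurable_to_config d' (X : measurableType d') (c : X -> config R d) :
  (forall A, measurable A -> measurable_fun setT (fun x => c x A)) ->
  measurable_fun setT c.
Proof.
move=> mc; apply: (measurability (\bigcup_(A in measurable)
  preimage_set_system setT (fun phi : config R d => phi A) measurable)) => //.
move=> _ [_ [A mA [B mB <-]] <-]; rewrite !setTI.
by have := mc A mA measurableT B mB; rewrite setTI.
Qed.

Section parametrized.
Context d' (X : measurableType d') (c : X -> config R d).
Hypothesis mc : measurable_fun setT c.

Let ker (x : X) : {measure set E -> \bar R} := c x.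

Let ker_measurable (A : set E) : measurable A -> measurable_fun setT (ker ^~ A).
Proof.
by move=> mA; have h := measurableT_comp (measurable_config_eval mA) mc; exact h.
Qed.

HB.instance Definition _ := isKernel.Build _ _ X E R ker ker_measurable.

(** Configurations form a kernel with finite, though not uniformly bounded, mass on each
cylinder; the cylinders increase to the whole space. *)
Lemma measurable_xsection_config (A : set (X * E)) : measurable A ->
  measurable_fun setT (fun x => c x (xsection A x)).
Proof.
move=> mA; pose B n : set E := cyl n%:R n%:R.
have mB n : measurable (B n) by exact: measurable_cyl.
have mAB n : measurable_fun setT (fun x => c x (xsection A x `&` B n)).
  have := @measurable_prod_subset_xsection_kernel _ _ X E R ker (B n) (mB n).
  case/(_ _ A mA) => // x; exists (fine (c x (B n)) + 1)%R => U mU.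
  have cB := cyl_config_lty (c x) n%:R n%:R.
  apply: (@le_lt_trans _ _ (c x (B n))).
    by apply: le_measure; rewrite ?inE//; exact: measurableI.
  rewrite -[ltLHS]fineK ?ge0_fin_numE// lte_fin.
  by rewrite ltrDl.
apply: (emeasurable_fun_cvg (fun n x => c x (xsection A x `&` B n))) => // x _.
have mx := measurable_xsection x mA.
have AE : \bigcup_n (xsection A x `&` B n) = xsection A x.
  rewrite -setI_bigcupr; apply/seteqP; split => [y []//|y Ay].
  by split => //; have [n yn] := cyl_cover y; exists n.
rewrite -[X in _ --> c x X]AE; apply: nondecreasing_cvg_mu.
- by move=> n; exact: measurableI.
- by apply: bigcupT_measurable => n; exact: measurableI.
- move=> n m nm; apply/subsetPset => y [Ay [y1 y2]]; split => //; split.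
    by rewrite (le_trans y1)// ler_nat.
  by rewrite (le_trans y2)// ler_nat.
Qed.

Import HBNNSimple.

Lemma measurable_integral_config (k : X * E -> \bar R) :
  (forall z, 0 <= k z) -> measurable_fun setT k ->
  measurable_fun setT (fun x => \int[c x]_y k (x, y)).
Proof.
move=> k0 mk; pose k_ := nnsfun_approx measurableT mk.
apply: (@measurable_fun_xsection_integral _ _ _ _ _ _ ker k_).
- by move=> a b ab; exact/nd_nnsfun_approx.
- by move=> z; exact/cvg_nnsfun_approx.
- by move=> n r; apply: measurable_xsection_config.
Qed.
End parametrized.

(** The diagonal is where all the half-spaces agree. *)
Lemma measurable_diagonal : measurable [set p : E * E | p.1 = p.2].
Proof.
pose H1 k := (@fst E E) @^-1` half_space k.
pose H2 k := (@snd E E) @^-1` half_space k.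
have mH1 k : measurable (H1 k).
  rewrite -[X in measurable X]setTI.
  exact: (@measurable_fst _ _ E E measurableT _ (measurable_half_space k)).
have mH2 k : measurable (H2 k).
  rewrite -[X in measurable X]setTI.
  exact: (@measurable_snd _ _ E E measurableT _ (measurable_half_space k)).
have -> : [set p : E * E | p.1 = p.2] =
    \bigcap_k ((H1 k `&` H2 k) `|` (~` H1 k `&` ~` H2 k)).
  apply/seteqP; split => [p /= pE k _|p h /=].
    have [h|h] := pselect (H1 k p); [left|right]; split => //.
      by move: h; rewrite /H1 /H2 /= pE.
    by move: h; rewrite /H1 /H2 /= pE.
  by apply: half_space_separates => k; have [[]|[]] := h k I; split.
apply: bigcapT_measurable => k; apply: measurableU; apply: measurableI => //.
  exact: measurableC.
exact: measurableC.
Qed.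

Lemma remove_simple (phi : config R d) y :
  simple_config phi -> simple_config (remove phi y).
Proof.
move=> sphi x; apply: le_trans (sphi x); apply: le_measure; rewrite ?inE.
- apply: measurableI; first exact: measurable_point1.
  exact: measurableC (measurable_point1 y).
- exact: measurable_point1.
- by move=> z [].
Qed.

Lemma points_remove (phi : config R d) y :
  points (remove phi y) = points phi `\ y.
Proof.
apply/seteqP; split => x.
  rewrite /points /= /mrestr => px; split; last first.
    move=> /= xy; move: px; rewrite xy (_ : [set y] `&` ~` [set y] = set0).
      by rewrite measure0 eqxx.
    by rewrite setICr.
  apply: contraNN px => /eqP px; rewrite -measure_le0 -px; apply: le_measure; rewrite ?inE.
  - apply: measurableI; first exact: measurable_point1.
    exact: measurableC (measurable_point1 y).
  - exact: measurable_point1.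
  - by move=> z [].
move=> [px xy]; rewrite /points /= /mrestr.
rewrite (_ : [set x] `&` ~` [set y] = [set x])//.
by apply/seteqP; split => [z []//|z ->]; split.
Qed.

(** The mass of A for the reduced configuration is the mass, for the full one, of the
section at x of the set of pairs (x, z) with z in A and z different from y x. *)
Lemma measurable_remove d' (X : measurableType d') (c : X -> config R d)
    (y : X -> E) : measurable_fun setT c -> measurable_fun setT y ->
  measurable_fun setT (fun x => remove (c x) (y x)).
Proof.
move=> mc my; apply: measurable_to_config => A mA.
pose B := [set p : X * E | A p.2 /\ y p.1 <> p.2].
have mB : measurable B.
  have -> : B = (@snd X E @^-1` A) `&`
      ~` ((fun p : X * E => (y p.1, p.2)) @^-1` [set p : E * E | p.1 = p.2]).
    by apply/seteqP; split.
  apply: measurableI.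
    rewrite -[X in measurable X]setTI.
    exact: (@measurable_snd _ _ X E measurableT _ mA).
  apply: measurableC; rewrite -[X in measurable X]setTI.
  have mp : measurable_fun setT (fun p : X * E => (y p.1, p.2)).
    apply/measurable_fun_pair => /=.
      by have h := measurableT_comp my (@measurable_fst _ _ X E); exact h.
    exact: measurable_snd.
  exact: (mp measurableT _ measurable_diagonal).
apply: eq_measurable_fun (measurable_xsection_config mc mB) => x _ /=.
rewrite /mrestr; congr (c x _); apply/seteqP; split => z.
  by rewrite /xsection/= inE => -[Az yz]; split => // zy; apply: yz.
by move=> [Az zy]; rewrite /xsection/= inE; split => // yz; apply: zy.
Qed.

End config_kernel.

Lemma esumZl (R : realType) (T : choiceType) (I : set T) (c : R)
    (a : T -> \bar R) : (0 <= c)%R -> (forall i, 0 <= a i) ->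
  \esum_(i in I) (c%:E * a i) = c%:E * \esum_(i in I) a i.
Proof.
move=> c0 a0; have sub (k : R) (b : T -> \bar R) : (0 <= k)%R -> (forall i, 0 <= b i) ->
    \esum_(i in I) (k%:E * b i) <= k%:E * \esum_(i in I) b i.
  move=> k0 b0; apply: ge_ereal_sup => _ [X XI <-].
  rewrite -ge0_mule_fsumr//; apply: lee_pmul => //; first by apply: fsume_ge0.
  by apply: ereal_sup_ubound; exists X.
apply/eqP; rewrite eq_le sub//=.
have [->|c1] := eqVneq c 0%R; first by rewrite mul0e esum_ge0// => i _; rewrite mul0e.
have {}c0 : (0 < c)%R by rewrite lt_neqAle eq_sym c1.
have -> : \esum_(i in I) a i = \esum_(i in I) (c^-1%:E * (c%:E * a i)).
  by apply: eq_esum => i _; rewrite muleA -EFinM mulVf// mul1e.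
rewrite -[leRHS]mul1e -(divff c1) EFinM -muleA lee_pmul//.
- by rewrite lee_fin ltW.
- apply: esum_ge0 => i _.
  by rewrite mule_ge0 ?lee_fin ?invr_ge0 ?mule_ge0// ?lee_fin ltW.
- apply: sub; first by rewrite invr_ge0 ltW.
  by move=> i; rewrite mule_ge0// lee_fin ltW.
Qed.

Section factorial_sums.
Context (R : realType) (d : nat).
Local Notation E := (spacetime R d).
Variable u : E -> E -> R.
Hypothesis u0 : forall a y, (0 <= u a y)%R.

(** The sum of u a y_1 ... u a y_n over ordered n-tuples of distinct points, see
[factorial_sumE]. Writing it as an iterated integral over reduced configurations makes it
jointly measurable in the centre a and the configuration, on configurations that are not
simple as well. *)
Fixpoint factorial_sum (n : nat) (p : E * config R d) : \bar R :=
  if n is m.+1 then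
    \int[p.2]_y ((u p.1 y)%:E * factorial_sum m (p.1, remove p.2 y))
  else 1.

Lemma factorial_sum_ge0 n p : 0 <= factorial_sum n p.
Proof.
elim: n p => //= n IH p; apply: integral_ge0 => y _.
by rewrite mule_ge0// lee_fin.
Qed.

(** Joint measurability in the centre and the configuration is needed because the Georgii-
Nguyen-Zessin formula integrates over both. *)
Lemma measurable_factorial_sum n :
  measurable_fun setT (fun p : E * E => u p.1 p.2) ->
  measurable_fun setT (factorial_sum n).
Proof.
move=> mu; elim: n => [|n IH] /=; first exact: measurable_cst.
pose k (q : (E * config R d) * E) : \bar R :=
  (u q.1.1 q.2)%:E * factorial_sum n (q.1.1, remove q.1.2 q.2).
apply: (@measurable_integral_config _ _ _ (E * config R d)%type snd _ k).
- exact: measurable_snd.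
- by move=> q; rewrite mule_ge0// ?lee_fin// factorial_sum_ge0.
have m11 : measurable_fun setT (fun q : (E * config R d) * E => q.1.1).
  by have h := measurableT_comp (@measurable_fst _ _ E (config R d))
    (@measurable_fst _ _ (E * config R d)%type E); exact h.
have m12 : measurable_fun setT (fun q : (E * config R d) * E => q.1.2).
  by have h := measurableT_comp (@measurable_snd _ _ E (config R d))
    (@measurable_fst _ _ (E * config R d)%type E); exact h.
have m2 := @measurable_snd _ _ (E * config R d)%type E.
apply: emeasurable_funM.
  apply/measurable_EFinP.
  have mp : measurable_fun setT (fun q : (E * config R d) * E => (q.1.1, q.2)).
    exact/measurable_fun_pair.
  by have h := measurableT_comp mu mp; exact h.
have mp : measurable_fun setT
    (fun q : (E * config R d) * E => (q.1.1, remove q.1.2 q.2)).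
  by apply/measurable_fun_pair => //; exact: measurable_remove.
by have h := measurableT_comp IH mp; exact h.
Qed.

Lemma esum_distinct_cons n (phi : config R d) (h : n.+1.-tuple E -> \bar R) :
  (forall z, 0 <= h z) ->
  \esum_(z in distinct_points n.+1 phi) h z =
  \esum_(y in points phi) \esum_(z in distinct_points n (remove phi y))
    h [tuple of y :: z].
Proof.
move=> h0; rewrite esum_esum//.
rewrite (@reindex_esum _ _ _ (points phi `*`` (fun y => distinct_points n (remove phi y)))
  _ (@cons_pair _ E n))//; split => /=.
- move=> [y z] /= [py [uz pz]]; split => /=.
    rewrite uz andbT; apply/negP => /tnthP[i yi].
    by have := pz i; rewrite points_remove => -[_ /=]; rewrite -yi.
  move=> i; case: (unliftP ord0 i) => [j ->|->]; last by rewrite tnth0.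
  by rewrite tnthS; have := pz j; rewrite points_remove => -[].
- by move=> p q _ _; exact: cons_pair_inj.
- move=> w /= [+ pw]; case/tupleP: w pw => y z pw /= /andP[yz uz].
  exists (y, z) => //; split => /=; first by have := pw ord0; rewrite tnth0.
  split => // i; rewrite points_remove; split.
    by have := pw (lift ord0 i); rewrite tnthS.
  by move=> /= zy; move: yz; rewrite -zy mem_tnth.
Qed.

Lemma esum_distinct0 (phi : config R d) (h : 0.-tuple E -> \bar R) :
  (forall z, 0 <= h z) ->
  \esum_(z in distinct_points 0 phi) h z = h [tuple].
Proof.
move=> h0; have -> : distinct_points 0 phi = [set [tuple]].
  apply/seteqP; split => [z _|_ ->]; first exact: tuple0.
  by split => // -[].
exact: esum_set1.
Qed.

Lemma factorial_sumE n a (phi : config R d) :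
  measurable_fun setT (fun p : E * E => u p.1 p.2) -> simple_config phi ->
  factorial_sum n (a, phi) =
  \esum_(z in distinct_points n phi) (\prod_(y <- z) u a y)%:E.
Proof.
move=> mu; elim: n phi => [|n IH] phi sphi.
  by rewrite esum_distinct0 ?big_nil// => z; rewrite lee_fin prodr_ge0.
have p0 (z : seq E) : 0 <= (\prod_(y <- z) u a y)%:E by rewrite lee_fin prodr_ge0.
rewrite esum_distinct_cons//= integral_config//; last 2 first.
- apply: emeasurable_funM.
    apply/measurable_EFinP.
    have mp := @measurable_pair1 _ _ E E a.
    by have h := measurableT_comp mu mp; exact h.
  have mp : measurable_fun setT (fun y : E => (a, remove phi y)).
    by apply/measurable_fun_pair => //; exact: measurable_remove.
  by have h := measurableT_comp (measurable_factorial_sum n mu) mp; exact h.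
- by move=> y; rewrite mule_ge0// ?lee_fin// factorial_sum_ge0.
apply: eq_esum => y _; rewrite IH; last exact: remove_simple.
have -> : (fun z : n.-tuple E => (\prod_(x <- [tuple of y :: z]) u a x)%:E) =
    (fun z => (u a y)%:E * (\prod_(x <- z) u a x)%:E).
  by apply/funext => z; rewrite /= big_cons EFinM.
by rewrite esumZl.
Qed.
End factorial_sums.

(** * Expansion of a finite product *)

Section distinct_sums.
Context (K : numFieldType) (T : eqType) (v : T -> K).

(** This is n! times the n-th elementary symmetric function of the values of v on X. *)
Fixpoint distinct_sum (n : nat) (X : seq T) : K :=
  if n is m.+1 then (\sum_(y <- X) v y * distinct_sum m (rem y X))%R else 1%R.

(** A tuple of distinct points either avoids x or has x at one of its n.+1 places. *)
Lemma distinct_sum_cons n x X : uniq (x :: X) ->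
  distinct_sum n.+1 (x :: X) =
  (distinct_sum n.+1 X + n.+1%:R * v x * distinct_sum n X)%R.
Proof.
elim: n X => [|n IH] X /andP[xX uX].
  by rewrite /= big_cons mulr1 mul1r mulr1 addrC.
rewrite [LHS]/= big_cons /= eqxx.
have -> : (\sum_(y <- X) v y *
    (\sum_(z <- if x == y then X else x :: rem y X)
      v z * distinct_sum n (rem z (if x == y then X else x :: rem y X))) =
  \sum_(y <- X) v y * distinct_sum n.+1 (x :: rem y X))%R.
  rewrite !big_seq; apply: eq_bigr => y yX.
  by case: eqVneq => // xy; move: xX; rewrite xy yX.
have -> : (\sum_(y <- X) v y * distinct_sum n.+1 (x :: rem y X) =
    distinct_sum n.+2 X + n.+1%:R * v x * distinct_sum n.+1 X)%R.
  rewrite [distinct_sum n.+1 X]/= mulr_sumr -big_split !big_seq.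
  apply: eq_bigr => y yX; rewrite IH; last first.
    by rewrite /= rem_uniq// andbT (contra (@mem_rem _ _ _ _)).
  by rewrite mulrDr; congr (_ + _)%R; rewrite mulrCA.
rewrite -[(\sum_(z <- X) v z * distinct_sum n (rem z X))%R]/(distinct_sum n.+1 X).
rewrite addrCA; congr (_ + _)%R.
by rewrite -[n.+2%:R]natr1 mulrDl mul1r mulrDl addrC.
Qed.

(** By [distinct_sum_cons], adding a point x subtracts v x times the sum cut one term
earlier; both sums have already reached the product, so it is multiplied by 1 - v x. *)
Lemma alternating_distinct_sum N X : uniq X -> (size X < N)%N ->
  (\sum_(n < N) (-1) ^+ n / n`!%:R * distinct_sum n X = \prod_(y <- X) (1 - v y))%R.
Proof.
elim: X N => [|x X IH] [|N]// uX sX.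
  rewrite big_nil big_ord_recl/= expr0 fact0 divr1 mulr1 big1 ?addr0// => i _.
  by rewrite /= big_nil mulr0.
have [xX uX'] := andP uX; rewrite big_cons mulrBl mul1r.
rewrite -{1}(IH N.+1)//; last by rewrite ltnW.
rewrite -(IH N)// mulr_sumr big_ord_recl [in RHS]big_ord_recl -addrA.
congr (_ + _)%R; rewrite -sumrB; apply: eq_bigr => i _.
rewrite distinct_sum_cons// mulrDr; congr (_ + _)%R.
rewrite /= /bump /= add1n factS natrM invfM exprS.
have f0 : (i`!%:R != 0 :> K)%R by rewrite pnatr_eq0 -lt0n fact_gt0.
by field; rewrite f0 nat1r pnatr_eq0.
Qed.

End distinct_sums.

Section finite_windows.
Context (R : realType) (d : nat).
Local Notation E := (spacetime R d).

(** Points outside X have weight 0, so every integral is a finite sum over X. *)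
Lemma factorial_sum_distinct_sum (u : E -> E -> R) n a (phi : config R d) (X : seq E) :
  (forall a y, (0 <= u a y)%R) ->
  measurable_fun setT (fun p : E * E => u p.1 p.2) -> simple_config phi ->
  uniq X -> (forall y, y \in X -> points phi y) ->
  (forall y, points phi y -> y \notin X -> u a y = 0%R) ->
  factorial_sum u n (a, phi) = (distinct_sum (u a) n X)%:E.
Proof.
move=> u0 mu; elim: n phi X => [//|n IH] phi X sphi uX Xphi phiX /=.
rewrite integral_config//; last 2 first.
- apply: emeasurable_funM.
    apply/measurable_EFinP.
    have mp := @measurable_pair1 _ _ E E a.
    by have h := measurableT_comp mu mp; exact h.
  have mp : measurable_fun setT (fun y : E => (a, remove phi y)).
    by apply/measurable_fun_pair => //; exact: measurable_remove.
  by have h := measurableT_comp (measurable_factorial_sum u0 n mu) mp; exact h.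
- by move=> y; rewrite mule_ge0// ?lee_fin// factorial_sum_ge0.
rewrite (esumID [set` X]); last first.
  by move=> y _; rewrite mule_ge0// ?lee_fin// factorial_sum_ge0.
rewrite [X in _ + X]esum1 ?adde0; last first.
  by move=> y [py /negP yX]; rewrite phiX// mul0e.
have -> : points phi `&` [set` X] = [set` X].
  by apply/seteqP; split => [y []//|y yX]; split => //; exact: Xphi.
rewrite esum_fset; last 2 first.
- exact: finite_seq.
- by move=> y _; rewrite mule_ge0// ?lee_fin// factorial_sum_ge0.
rewrite -fsbig_seq// -sumEFin big_seq [RHS]big_seq; apply: eq_bigr => y yX.
rewrite (IH _ (rem y X)) ?EFinM//.
- exact: remove_simple.
- exact: rem_uniq.
- move=> z; rewrite mem_rem_uniq// inE => /andP[/eqP zy zX].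
  by rewrite points_remove; split => //; exact: Xphi.
- move=> z; rewrite points_remove => -[pz zy].
  rewrite mem_rem_uniq// inE negb_and negbK => /orP[/eqP//|]; exact: phiX.
Qed.

Lemma window_points (r t : R) a (phi : config R d) : (0 <= r)%R ->
  exists X : seq E, [/\ uniq X, forall y, y \in X -> points phi y &
    forall y, points phi y -> y \notin X -> ~ window r t a y].
Proof.
move=> r0; have : finite_set (points phi `&` window r t a).
  apply: points_finite; first exact: measurable_window.
  apply: config_locally_finite; first exact: measurable_window.
  exact: window_point_bounded.
case/finite_seqP => X XE; exists (undup X); split; first exact: undup_uniq.
- move=> y; rewrite mem_undup => yX.
  have : [set` X] y by []. by rewrite -XE => -[].
- move=> y py; rewrite mem_undup => /negP yX wy; apply: yX.
  by have : (points phi `&` window r t a) y by []; rewrite XE.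
Qed.

End finite_windows.

(** * Replacing the process by an everywhere simple one *)

Section ae_equal_integrals.
Context d (T : measurableType d) (R : realType).
Variable mu : {measure set T -> \bar R}.

Import HBNNSimple.

(** The integral of a nonnegative function is a supremum over the simple functions below it,
and cutting a simple function to 0 on a null set does not change its integral. It serves for
sums over points, which need not be measurable where the process is not simple. *)
Lemma ge0_ae_eq_integral_nonmeasurable (f g : T -> \bar R) :
  (forall x, 0 <= f x) -> (forall x, 0 <= g x) ->
  (\forall x \ae mu, f x = g x) -> \int[mu]_x f x = \int[mu]_x g x.
Proof.
have sub (f1 f2 : T -> \bar R) : (forall x, 0 <= f1 x) -> (forall x, 0 <= f2 x) ->
    (\forall x \ae mu, f1 x = f2 x) -> \int[mu]_x f1 x <= \int[mu]_x f2 x.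
  move=> f10 f20 [N [mN N0 fN]]; rewrite ge0_integralTE//.
  apply: ge_ereal_sup => _ [h hf <-].
  pose h' := proj_nnsfun h (measurableC mN).
  rewrite -integralT_nnsfun; have -> : \int[mu]_x (h x)%:E = \int[mu]_x (h' x)%:E.
    apply: ge0_ae_eq_integral => //.
    - exact/measurable_EFinP.
    - exact/measurable_EFinP.
    - by move=> x _; rewrite lee_fin.
    - by move=> x _; rewrite lee_fin.
    exists N; split => // x /= hx; apply: contrapT => Nx; apply: hx => _.
    by rewrite mindicE mem_set ?mulr1.
  rewrite integralT_nnsfun ge0_integralTE//.
  apply: ereal_sup_ubound; exists h' => // x; rewrite /h' /= mindicE.
  case: (boolP (x \in _)) => [|_]; last by rewrite mulr0.
  rewrite inE mulr1 => nNx; apply: le_trans (hf x) _.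
  have -> // : f1 x = f2 x by apply: contrapT => fx; apply: nNx; exact: fN.
move=> f0 g0 fg; apply/eqP; rewrite eq_le !sub//.
by apply: filterS fg => x ->.
Qed.
End ae_equal_integrals.

Section simple_version.
Context (R : realType) (d : nat) (dO : measure_display)
  (Omega : measurableType dO) (P : probability Omega R).
Local Notation E := (spacetime R d).
Variable Y : {RV P >-> config R d}.

(** The empty configuration replaces the process on a null event. *)
Lemma exists_simple_version : simple_process Y ->
  exists Z : {RV P >-> config R d},
    (forall w, simple_config (Z w)) /\ \forall w \ae P, Z w = Y w.
Proof.
move=> [N [mN N0 YN]].
pose Z w : config R d := if w \in N then point else Y w.
have mZ : measurable_fun setT Z.
  apply: measurable_to_config => A mA.
  have -> : (fun w => Z w A) = (fun w => if w \in N then 0 else Y w A).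
    by apply/funext => w; rewrite /Z; case: ifP.
  apply: measurable_fun_ifT => //.
    by apply: (measurable_fun_bool true); rewrite setTI preimage_mem_true.
  have h := measurableT_comp (measurable_config_eval mA) (measurable_funPT Y).
  exact h.
pose mfZ : {mfun Omega >-> config R d} := HB.pack Z (isMeasurableFun.Build _ _ _ _ Z mZ).
exists mfZ; split => [w|].
  rewrite /= /Z; case: ifPn => [_ y|]; first by rewrite /= /mzero lee01.
  by rewrite notin_setE => nN; apply: contrapT => nY; apply: nN; exact: YN.
exists N; split => // w /= ZY; apply: contrapT => nN; apply: ZY.
by rewrite /Z memNset.
Qed.

Variable Z : {RV P >-> config R d}.
Hypothesis ZY : \forall w \ae P, Z w = Y w.

Lemma factorial_moment_version n (h : n.-tuple E -> \bar R) :
  (forall z, 0 <= h z) -> factorial_moment Z h = factorial_moment Y h.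
Proof.
move=> h0; apply: ge0_ae_eq_integral_nonmeasurable.
- by move=> w; exact: esum_ge0.
- by move=> w; exact: esum_ge0.
- by apply: filterS ZY => w ->.
Qed.

Lemma product_density_version n (rho : n.-tuple E -> R) :
  product_density Y rho -> product_density Z rho.
Proof.
case=> m1 r0 sym fin mom; split => // [r t|h mh h0].
  by rewrite factorial_moment_version ?fin// => z; rewrite lee_fin.
by rewrite factorial_moment_version ?mom.
Qed.

Lemma papangelou_version (plam : E * config R d -> R) :
  papangelou Y plam -> papangelou Z plam.
Proof.
case=> mp p0 gnz; split; [exact: mp|exact: p0|move=> g mg g0].
transitivity (\int[P]_w (\esum_(y in points (Y w)) g (y, remove (Y w) y))).
  apply: ge0_ae_eq_integral_nonmeasurable.
  - by move=> w; exact: esum_ge0.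
  - by move=> w; exact: esum_ge0.
  - by apply: filterS ZY => w ->.
rewrite (gnz g mg g0); apply: eq_integral => y _.
apply: ge0_ae_eq_integral_nonmeasurable.
- by move=> w; rewrite mule_ge0// lee_fin.
- by move=> w; rewrite mule_ge0// lee_fin.
- by apply: filterS ZY => w ->.
Qed.
End simple_version.

(** * Real series *)

Section real_series.
Local Open Scope ring_scope.
Context (R : realType).
Implicit Types a b u : nat -> R.

Lemma series_ord u n : series u n = \sum_(i < n) u i.
Proof. by rewrite seriesEord. Qed.

Definition cauchy_product a b (n : nat) : R := \sum_(k < n.+1) a k * b (n - k)%N.

Lemma series_cauchy_product a b N :
  series (cauchy_product a b) N = \sum_(i < N) a i * series b (N - i)%N.
Proof.
elim: N => [|N IH]; first by rewrite series_ord !big_ord0.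
rewrite seriesS IH /cauchy_product; apply/esym.
rewrite (eq_bigr (fun i : 'I_N.+1 => a i * series b (N - i)%N + a i * b (N - i)%N)).
  rewrite big_split/= addrC; congr (_ + _).
  by rewrite big_ord_recr/= subnn series_ord big_ord0 mulr0 addr0.
by move=> i _; rewrite subSn 1?seriesS 1?mulrDr 1?addrC// -ltnS.
Qed.

Lemma cauchy_product_ge0 a b n : (forall n, 0 <= a n) -> (forall n, 0 <= b n) ->
  0 <= cauchy_product a b n.
Proof. by move=> a0 b0; apply: sumr_ge0 => i _; exact: mulr_ge0. Qed.

Lemma ler_norm_cauchy_product a b n :
  `|cauchy_product a b n| <= cauchy_product (fun k => `|a k|) (fun k => `|b k|) n.
Proof.
apply: le_trans (ler_norm_sum _ _ _) _.
by apply: ler_sum => i _; rewrite normrM.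
Qed.

(** With A, B, C the partial sums of a, b and the product, C_N <= A_N B_N and A_N B_N <=
C_(2N). *)
Lemma cvg_cauchy_product_ge0 a b : (forall n, 0 <= a n) -> (forall n, 0 <= b n) ->
  cvgn (series a) -> cvgn (series b) ->
  series (cauchy_product a b) @ \oo --> limn (series a) * limn (series b).
Proof.
move=> a0 b0 ca cb.
have nda : nondecreasing_seq (series a) by exact: nondecreasing_series.
have ndb : nondecreasing_seq (series b) by exact: nondecreasing_series.
have ndc : nondecreasing_seq (series (cauchy_product a b)).
  by apply: nondecreasing_series => n _ _; exact: cauchy_product_ge0.
have leA n : series a n <= limn (series a) by exact: nondecreasing_cvgn_le.
have leB n : series b n <= limn (series b) by exact: nondecreasing_cvgn_le.
have B0 n : 0 <= series b n by rewrite series_ord; apply: sumr_ge0.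
have le1 N : series (cauchy_product a b) N <= limn (series a) * limn (series b).
  rewrite series_cauchy_product; apply: (@le_trans _ _ (series a N * limn (series b))).
    rewrite [series a N]series_ord mulr_suml; apply: ler_sum => i _; exact: ler_wpM2l.
  by rewrite ler_wpM2r// (le_trans (B0 0%N)).
have ge1 N : series a N * series b N <= series (cauchy_product a b) N.*2.
  rewrite series_cauchy_product -addnn big_split_ord/= [series a N]series_ord mulr_suml.
  rewrite -[leLHS]addr0; apply: lerD.
    apply: ler_sum => i _; apply: ler_wpM2l => //; apply: ndb.
    by rewrite -addnBA ?leq_addr// ltnW.
  by apply: sumr_ge0 => i _; exact: mulr_ge0.
have cc : cvgn (series (cauchy_product a b)).
  by apply: nondecreasing_is_cvgn => //;
    exists (limn (series a) * limn (series b)) => _ [n _ <-].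
suff <- : limn (series (cauchy_product a b)) = limn (series a) * limn (series b) by [].
apply/eqP; rewrite eq_le; apply/andP; split.
  by apply: limr_le => //; exact: nearW.
have cab : series a \* series b @ \oo --> limn (series a) * limn (series b).
  exact: cvgM.
rewrite -(cvg_lim _ cab)//; apply: limr_le; first exact: cvgP cab.
apply: nearW => n; apply: le_trans (ge1 n) _.
exact: nondecreasing_cvgn_le.
Qed.

Lemma is_cvg_normed_cauchy_product a b :
  cvgn (series (fun n => `|a n|)) -> cvgn (series (fun n => `|b n|)) ->
  cvgn (series (fun n => `|cauchy_product a b n|)).
Proof.
move=> ca cb; apply: (series_le_cvg _ _ (@ler_norm_cauchy_product a b)) => //.
  by move=> n; exact: cauchy_product_ge0.
by apply: cvgP; exact: cvg_cauchy_product_ge0.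
Qed.

(** The defect A_N B_N - C_N is at most the same defect for the absolute values, which tends
to 0 by the nonnegative case. *)
Lemma cvg_cauchy_product a b :
  cvgn (series (fun n => `|a n|)) -> cvgn (series (fun n => `|b n|)) ->
  series (cauchy_product a b) @ \oo --> limn (series a) * limn (series b).
Proof.
move=> ca cb; set a' := fun n => `|a n|; set b' := fun n => `|b n|.
have c1 : cvgn (series a) by exact: normed_cvg.
have c2 : cvgn (series b) by exact: normed_cvg.
have cab : series a \* series b @ \oo --> limn (series a) * limn (series b) by exact: cvgM.
have cab' : series a' \* series b' @ \oo --> limn (series a')
  * limn (series b') by exact: cvgM.
have cc' : series (cauchy_product a' b') @ \oo --> limn (series a') * limn (series b').
  by apply: cvg_cauchy_product_ge0 => // n; exact: normr_ge0.
have d0 : (fun N => (series a' \* series b') N - series (cauchy_product a' b') N) @ \oo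
  --> (0 : R).
  by rewrite -(subrr (limn (series a') * limn (series b'))); exact: cvgB.
have inc M N : (M <= N)%N -> `|series b N - series b M| <= series b' N - series b' M.
  move=> MN; rewrite !sub_series_geq//; exact: ler_norm_sum.
have dle N : `|(series a \* series b) N - series (cauchy_product a b) N| <=
    (series a' \* series b') N - series (cauchy_product a' b') N.
  rewrite !series_cauchy_product /= [series a N]series_ord [series a' N]series_ord.
  rewrite !mulr_suml -!sumrB; apply: le_trans (ler_norm_sum _ _ _) _.
  apply: ler_sum => i _; rewrite -!mulrBr normrM ler_wpM2l//.
  by apply: inc; rewrite leq_subr.
have d1 : (fun N => (series a \* series b) N - series (cauchy_product a b) N) @ \oo -->
  (0 : R).
  have near_le : \forall N \near \oo, (cst 0 N : R) <=
      `|(series a \* series b) N - series (cauchy_product a b) N| <=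
      (series a' \* series b') N - series (cauchy_product a' b') N.
    by apply: nearW => N; rewrite normr_ge0; exact: dle.
  by apply/norm_cvg0P; exact: (squeeze_cvgr near_le (cvg_cst (0 : R)) d0).
have -> : series (cauchy_product a b) = (fun N => (series a \* series b) N -
    ((series a \* series b) N - series (cauchy_product a b) N)).
  by apply/funext => N; rewrite subKr.
by rewrite -[X in _ --> X]subr0; exact: cvgB.
Qed.

(** Eventually u k <= q ^ k for some q < 1, which a geometric series dominates. *)
Lemma root_test u : (forall n, 0 <= u n) ->
  (limn_esup (fun n => (u n)%:E `^ n%:R^-1) < 1)%E -> cvgn (series u).
Proof.
move=> u0; rewrite limn_esup_lim.
have /cvg_lim -> // := @cvg_esups_inf R (fun n => (u n)%:E `^ n%:R^-1)%E.
case/ereal_inf_lt => _ [N _ <-] lt1.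
have ge0 : (0 <= esups (fun n => (u n)%:E `^ n%:R^-1) N)%E.
  apply: (@le_trans _ _ ((u N)%:E `^ N%:R^-1)%E); first exact: poweR_ge0.
  by apply: ereal_sup_ubound; exists N => /=.
have [q qE] : exists q : R, (esups (fun n => (u n)%:E `^ n%:R^-1) N = q%:E)%E.
  by move: ge0 lt1; case: (esups _ N) => [q| |]// _ _; exists q.
have q1 : q < 1 by move: lt1; rewrite qE lte_fin.
have uq k : (N < k)%N -> u k <= q ^+ k.
  move=> Nk; have k0 : (0 < k)%N by exact: leq_ltn_trans Nk.
  have : ((u k)%:E `^ k%:R^-1 <= q%:E)%E.
    by rewrite -qE; apply: ereal_sup_ubound; exists k => //=; exact: ltnW.
  rewrite poweR_EFin lee_fin => h.
  have -> : u k = (u k `^ k%:R^-1) ^+ k.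
    by rewrite -powR_mulrn ?powR_ge0// -powRrM mulVf ?powRr1// pnatr_eq0 -lt0n.
  by apply: lerXn2r => //; rewrite nnegrE ?powR_ge0// (le_trans _ h)// powR_ge0.
(* p, unlike q, is positive, so the constant M can absorb the first terms of u *)
pose p := Num.max q 2^-1.
have p0 : 0 < p by rewrite lt_max invr_gt0 ltr0n orbT.
have p1 : p < 1 by rewrite gt_max q1 invf_lt1// ltr1n.
have q0 : 0 <= q by move: ge0; rewrite qE lee_fin.
pose M := 1 + \sum_(k < N.+1) u k / p ^+ k.
have M1 : 1 <= M by rewrite lerDl; apply: sumr_ge0 => k _;
  rewrite divr_ge0// exprn_ge0// ltW.
apply: (@series_le_cvg _ _ (geometric M p)) => //.
- by move=> n; rewrite /geometric/= mulr_ge0 ?exprn_ge0 ?(ltW p0)// (le_trans _ M1).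
- move=> k; rewrite /geometric /=; have [kN|Nk] := leqP k N.
    rewrite -ler_pdivrMr ?exprn_gt0//.
    rewrite /M (bigD1 (Ordinal (kN : (k < N.+1)%N)))//= addrCA lerDl addr_ge0//.
    by apply: sumr_ge0 => j _; rewrite divr_ge0// exprn_ge0// ltW.
  apply: le_trans (uq _ Nk) _; rewrite -[leLHS]mul1r ler_pM// ?exprn_ge0//.
  by apply: lerXn2r => //; rewrite ?nnegrE ?(ltW p0)// le_max lexx.
- by apply: is_cvg_geometric_series; rewrite ger0_norm// ltW.
Qed.

End real_series.

(** * Integrating an alternating series term by term *)

Section alternating_integral.
Context d (T : measurableType d) (R : realType).
Variable mu : {measure set T -> \bar R}.
Variables (F : nat -> T -> R) (G : T -> R) (c : nat -> R).
Hypothesis F0 : forall n x, (0 <= F n x)%R.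
Hypothesis mF : forall n, measurable_fun setT (F n).
Hypothesis intF : forall n, \int[mu]_x (F n x)%:E = (c n)%:E.
Hypothesis cc : cvgn (series c).
Hypothesis FG : forall x, series (fun n => (-1) ^+ n * F n x)%R @ \oo --> G x.

(** Dominated convergence for the partial sums, dominated by the sum of all the F n. *)
Lemma integral_alternating_series :
  \int[mu]_x (G x)%:E = (limn (series (fun n => (-1) ^+ n * c n)%R))%:E.
Proof.
have c0 n : (0 <= c n)%R.
  by rewrite -lee_fin -intF; apply: integral_ge0 => x _; rewrite lee_fin.
pose f_ N x := (series (fun n => (-1) ^+ n * F n x)%R N)%:E.
pose g x := \sum_(n <oo) (F n x)%:E.
have mf N : measurable_fun setT (f_ N).
  apply/measurable_EFinP; rewrite /f_; under eq_fun do rewrite series_ord.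
  apply: measurable_sum => n; exact: measurable_funM.
have mg : measurable_fun setT g.
  apply: ge0_emeasurable_sum => [n x _ _|n _]; first by rewrite lee_fin.
  exact/measurable_EFinP.
have g0 x : 0 <= g x by apply: nneseries_ge0 => n _ _; rewrite lee_fin.
have ig : mu.-integrable setT g.
  apply/integrableP; split => //; under eq_integral do rewrite gee0_abs//.
  rewrite /g integral_nneseries//; last 2 first.
  - by move=> n; exact/measurable_EFinP.
  - by move=> n x _; rewrite lee_fin.
  under eq_eseriesr do rewrite intF.
  have -> : \sum_(n <oo) (c n)%:E = (limn (series c))%:E; last exact: ltry.
  rewrite -EFin_lim//; congr (limn _); apply/funext => N /=.
  by rewrite seriesEnat /= sumEFin.
have fg x n : `|f_ n x| <= g x.
  rewrite /f_ series_ord; apply: (@le_trans _ _ (\sum_(0 <= k < n) (F k x)%:E)).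
    rewrite big_mkord sumEFin lee_fin (le_trans (ler_norm_sum _ _ _))//.
    by apply: ler_sum => i _; rewrite normrM normrX normrN1 expr1n mul1r ger0_norm.
  by apply: nneseries_lim_ge => k _; rewrite lee_fin.
have mG : measurable_fun setT (fun x => (G x)%:E).
  apply: (emeasurable_fun_cvg f_) => // x _.
  by apply: cvg_EFin; [exact: nearW|exact: FG].
have fG : {ae mu, forall x, [set: T] x -> f_ ^~ x @ \oo --> (G x)%:E}.
  by apply: aeW => x _; apply: cvg_EFin; [exact: nearW|exact: FG].
have [_ _ cvgI] := dominated_convergence measurableT mf mG fG ig
  (aeW _ (fun x n _ => fg x n)).
have intf N : \int[mu]_x f_ N x = (series (fun n => (-1) ^+ n * c n)%R N)%:E.
  have iF n : mu.-integrable setT (EFin \o F n).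
    apply/integrableP; split; first exact/measurable_EFinP.
    under eq_integral do rewrite /= ger0_norm//.
    by rewrite intF ltry.
  rewrite series_ord -sumEFin.
  transitivity (\int[mu]_x (\sum_(n < N) ((-1) ^+ n)%:E * (EFin \o F n) x)).
    by apply: eq_integral => x _; rewrite /f_ series_ord -sumEFin.
  rewrite integral_sum//; last by move=> n; exact: integrableZl.
  by apply: eq_bigr => n _; rewrite integralZl// intF.
rewrite -(cvg_lim _ cvgI)//= (_ : (fun n => _) =
    EFin \o series (fun n => (-1) ^+ n * c n)%R); last first.
  by apply/funext => N; rewrite intf.
rewrite EFin_lim//; apply: normed_cvg; rewrite (_ : [normed _] = series c)//.
apply/funext => N; rewrite /series/=; apply: eq_bigr => n _.
by rewrite normrM normrX normrN1 expr1n mul1r ger0_norm.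
Qed.
End alternating_integral.

(** * Intensity and weights *)

Section weights.
Context (R : realType) (d : nat) (dO : measure_display)
  (Omega : measurableType dO) (P : probability Omega R).
Variable Y : {RV P >-> config R d}.
Local Notation E := (spacetime R d).
Variables rho xi : forall n, n.-tuple E -> R.
Hypothesis hY : IRMS Y rho xi.
Local Notation lam := (intensity_inf rho).
Local Notation leb := (lebesgue_spacetime R d).

Definition indicator_prod (B : set E) (s : seq E) : R := (\prod_(y <- s) \1_B y)%R.

Lemma indicator_prod_ge0 B s : (0 <= indicator_prod B s)%R.
Proof. by apply: prodr_ge0 => y _; rewrite indicE. Qed.

Lemma indicator_prod_cons B x s :
  indicator_prod B (x :: s) = (\1_B x * indicator_prod B s)%R.
Proof. by rewrite /indicator_prod big_cons. Qed.

Lemma indicator_prod_mask B b s : size b = size s ->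
  indicator_prod B s =
  (indicator_prod B (mask b s) * indicator_prod B (mask (map negb b) s))%R.
Proof.
elim: s b => [|x s IH] [|c b]//= sb; first by rewrite /indicator_prod !big_nil mulr1.
case: sb => sb; case: c.
- by rewrite !indicator_prod_cons (IH b)// mulrA.
- by rewrite !indicator_prod_cons (IH b)// mulrCA.
Qed.

Lemma seq_measurable_prod (f : E -> R) : measurable_fun setT f ->
  seq_measurable (fun s => (\prod_(y <- s) f y)%:E).
Proof.
move=> mf n; apply/measurable_EFinP.
have -> : (fun z : n.-tuple E => \prod_(y <- z) f y)%R =
    (fun z => \prod_(i <- enum 'I_n) f (tnth z i))%R.
  by apply/funext => z; rewrite big_tuple -big_enum.
apply: measurable_prod => i _ /=.
by have h := measurableT_comp mf (@measurable_tnth _ E n i); exact h.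
Qed.

Lemma seq_measurable_indicator_prod B : measurable B ->
  seq_measurable (EFin \o indicator_prod B).
Proof. by move=> mB; apply: seq_measurable_prod; exact: measurable_indic. Qed.

Lemma indicator_prod_cyl (r t : R) n (z : n.-tuple E) :
  indicator_prod (cyl r t) z = \1_(cyln r t n) z.
Proof.
rewrite indicE; have [zc|zc] := boolP (z \in cyln r t n).
  rewrite /indicator_prod big_tuple big1// => i _.
  by rewrite indicE mem_set//; move: zc; rewrite inE; exact.
have /existsNP[i nzi] : ~ forall i, cyl r t (tnth z i).
  by move=> h; move/negP: zc; apply; rewrite inE.
by rewrite /indicator_prod big_tuple (bigD1 i)//= indicE memNset// mul0r.
Qed.

Lemma intensity_ge0 y : (0 <= intensity rho y)%R.
Proof. by case: (IRMS_density hY (isT : (0 < 1)%N)) => _ r0 _ _ _; exact: r0. Qed.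

Lemma intensity_inf_le y : (lam <= intensity rho y)%R.
Proof.
apply: ge_inf; last by exists y.
by exists 0%R => _ [x _ <-]; exact: intensity_ge0.
Qed.

Lemma intensity_inf_gt0 : (0 < lam)%R. Proof. exact: IRMS_intensity hY. Qed.

Lemma intensity_gt0 y : (0 < intensity rho y)%R.
Proof. exact: lt_le_trans intensity_inf_gt0 (intensity_inf_le y). Qed.

Lemma measurable_intensity : measurable_fun setT (intensity rho).
Proof.
case: (IRMS_density hY (isT : (0 < 1)%N)) => m1 _ _ _ _.
have mt : measurable_fun setT (fun y : E => [tuple y] : 1.-tuple E).
  by apply/measurable_fun_tnthP => i; apply: eq_measurable_fun (@measurable_id _ E
    setT) => y _;
     rewrite /= ord1 tnth0.
by have h := measurableT_comp m1 mt; exact h.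
Qed.

Lemma rho_ge0 n (z : n.+1.-tuple E) : (0 <= rho z)%R.
Proof. by case: (IRMS_density hY (ltn0Sn n)). Qed.

Lemma rw_density_rho n (z : n.+1.-tuple E) :
  rw_density rho z = (rho z / \prod_(y <- z) intensity rho y)%R.
Proof. by rewrite rw_densityE /reweighted_density [in RHS]big_tuple. Qed.

Lemma prod_intensity_gt0 (s : seq E) : (0 < \prod_(y <- s) intensity rho y)%R.
Proof. by apply: prodr_gt0 => y _; exact: intensity_gt0. Qed.

Lemma rw_density_ge0 s : (0 <= rw_density rho s)%R.
Proof.
case: s => [|x s]; first exact: ler01.
have := rw_density_rho (in_tuple (x :: s)); rewrite /= => ->.
by rewrite divr_ge0 ?rho_ge0// ltW// (prod_intensity_gt0 (x :: s)).
Qed.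

Lemma seq_measurable_rw_density : seq_measurable (EFin \o rw_density rho).
Proof.
case=> [|n].
  apply: eq_measurable_fun (@measurable_cst _ _ _ _ setT (1 : \bar R)) => z _.
  by rewrite tuple0.
apply/measurable_EFinP; rewrite (_ : (fun _ => _) = fun z : n.+1.-tuple E =>
    rho z * (\prod_(y <- z) intensity rho y)^-1)%R; last first.
  by apply/funext => z; rewrite /= rw_density_rho.
case: (IRMS_density hY (ltn0Sn n)) => mr _ _ _ _; apply: measurable_funM => //.
under eq_fun do rewrite -powR_inv1 ?(ltW (prod_intensity_gt0 _))//.
apply: (@measurableT_comp _ _ _ _ _ _ (fun x : R => powR x (-1)%R)) => //.
by apply/measurable_EFinP; exact: (seq_measurable_prod measurable_intensity).
Qed.
End weights.

(** * Moments in a window *)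

Section moments.
Context (R : realType) (d : nat) (dO : measure_display)
  (Omega : measurableType dO) (P : probability Omega R).
Variable Y : {RV P >-> config R d}.
Local Notation E := (spacetime R d).
Variables rho xi : forall n, n.-tuple E -> R.
Hypothesis hY : IRMS Y rho xi.
Local Notation lam := (intensity_inf rho).
Local Notation leb := (lebesgue_spacetime R d).

Lemma seq_measurable_indicator_rw_density B : measurable B ->
  seq_measurable (fun s : seq E => (indicator_prod B s * rw_density rho s)%:E).
Proof.
move=> mB n; apply/measurable_EFinP; apply: measurable_funM.
  by apply/measurable_EFinP; exact: seq_measurable_indicator_prod.
by apply/measurable_EFinP; exact: (seq_measurable_rw_density hY).
Qed.

Lemma indicator_rw_density_ge0 B s : 0 <= (indicator_prod B s * rw_density rho s)%:E.
Proof. by rewrite lee_fin mulr_ge0 ?indicator_prod_ge0// (rw_density_ge0 hY). Qed.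

Lemma intensity_prod_ge (s : seq E) :
  (lam ^+ size s <= \prod_(y <- s) intensity rho y)%R.
Proof.
elim: s => [|y s IH]; first by rewrite big_nil.
rewrite big_cons exprS ler_pM ?exprn_ge0 ?(intensity_inf_le hY)//;
  exact: ltW (intensity_inf_gt0 hY).
Qed.

(** Factorial moment measures are locally finite and the intensity is bounded away from 0. *)
Lemma seq_integral_rw_density_lty (r t : R) n :
  seq_integral leb n (fun s : seq E => (indicator_prod (cyl r t) s
    * rw_density rho s)%:E) < +oo.
Proof.
case: n => [|n].
  rewrite seq_integral0 ?ltry//; exact: indicator_rw_density_ge0.
case: (IRMS_density hY (ltn0Sn n)) => mr r0 _ fin mom.
have l0 := intensity_inf_gt0 hY.
have mc : measurable_fun setT (fun z : n.+1.-tuple E => (\1_(cyln r t n.+1) z)%:E : \bar R).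
  apply: eq_measurable_fun (@seq_measurable_indicator_prod R d _ (measurable_cyl r t)
    n.+1) => z _.
  by rewrite /= indicator_prod_cyl.
have := fin r t; rewrite mom//.
have k0 : (0 <= lam ^- n.+1)%R by rewrite invr_ge0 exprn_ge0// ltW.
have mcr : measurable_fun setT (fun z : n.+1.-tuple E =>
    (\1_(cyln r t n.+1) z)%:E * (rho z)%:E : \bar R).
  by apply: emeasurable_funM => //; exact/measurable_EFinP.
have cr0 (z : n.+1.-tuple E) : 0 <= (\1_(cyln r t n.+1) z)%:E * (rho z)%:E.
  by rewrite mule_ge0// lee_fin.
move=> Ioo; apply: (@le_lt_trans _ _ ((lam ^- n.+1)%:E *
  \int[tuple_power leb n.+1]_z ((\1_(cyln r t n.+1) z)%:E * (rho z)%:E))); last first.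
  by rewrite lte_mul_pinfty.
rewrite -ge0_integralZl//; apply: ge0_le_integral => //.
- by move=> z _; exact: indicator_rw_density_ge0.
- exact: (seq_measurable_indicator_rw_density (measurable_cyl r t)).
- exact: measurable_funeM.
- move=> z _; rewrite indicator_prod_cyl rw_density_rho /= -!EFinM lee_fin [leRHS]mulrCA.
  apply: ler_wpM2l => //; rewrite mulrC ler_wpM2r ?r0//.
  rewrite lef_pV2 ?posrE ?exprn_gt0 ?(prod_intensity_gt0 hY)//.
  by have := intensity_prod_ge z; rewrite size_tuple.
Qed.

(** Stationarity of xi holds off a null set of tuples depending on c; [ae_subseq] makes it
hold for all the subsequences that [rw_density_map] asks for. *)
Lemma rw_density_translation_invariant (c : E) n :
  {ae tuple_power leb n, forall z : n.-tuple E,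
     rw_density rho (map (translate c) z) = rw_density rho z}.
Proof.
have := @ae_subseq _ E R leb (fun s => seqfun xi (map (translate c) s) = seqfun xi s).
have st k : (0 < k)%N -> {ae tuple_power leb k, forall z : k.-tuple E,
    seqfun xi (map (translate c) z) = seqfun xi z}.
  move=> k0; have := IRMS_stationary hY k0 c; apply: filterS => z h.
  by rewrite -[map _ _]/(val (translate_tuple c z)) !seqfunE h.
move=> /(_ st n); apply: filterS => z h.
exact: (rw_density_map (IRMS_correlation hY)).
Qed.

(** The number G_n of the opening comment: it does not depend on the centre of the window. *)
Definition window_moment (r t : R) n : \bar R :=
  seq_integral leb n (fun s : seq E => (indicator_prod (cyl r t) s * rw_density rho s)%:E).

Lemma indicator_window_translate (r t : R) (a : E) (s : seq E) :
  indicator_prod (window r t a) (map (translate a) s) = indicator_prod (cyl r t) s.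
Proof.
rewrite /indicator_prod big_map; apply: eq_bigr => y _; rewrite !indicE.
suff -> : (translate a y \in window r t a) = (y \in cyl r t) by [].
by apply/idP/idP; rewrite !inE => /window_translate.
Qed.

Lemma window_momentE (r t : R) (a : E) n :
  seq_integral leb n (fun s : seq E => (indicator_prod (window r t a) s
    * rw_density rho s)%:E) =
  window_moment r t n.
Proof.
have mF := seq_measurable_indicator_rw_density (measurable_window r t a).
rewrite -(seq_integral_map n (translate_invariant a) mF).
apply: ge0_ae_eq_integral => //.
- have := @seq_measurable_mapi _ E R (fun=> translate a) _
    (fun=> measurable_translate a) mF n.
  by apply: eq_measurable_fun => z _; rewrite mapi_map.
- exact: (seq_measurable_indicator_rw_density (measurable_cyl r t)).
- by move=> z _; exact: indicator_rw_density_ge0.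
- by move=> z _; exact: indicator_rw_density_ge0.
- have := rw_density_translation_invariant a n; apply: filterS => z h _.
  by rewrite indicator_window_translate h.
Qed.

Lemma window_moment_cyln (r t : R) n : (0 < n)%N ->
  \int[tuple_power leb n]_(z in cyln r t n) (reweighted_density rho z)%:E =
  window_moment r t n.
Proof.
case: n => // n _; rewrite integral_mkcond; apply: eq_integral => z _.
rewrite indicator_prod_cyl rw_densityE patchE indicE.
by case: ifP => _; rewrite ?mul1r ?mul0r.
Qed.

(** The factor of W at y is 1 - thinning a y. *)
Definition thinning (r t : R) (a y : E) : R :=
  (lam * \1_(window r t a) y / intensity rho y)%R.

Lemma thinning_ge0 r t a y : (0 <= thinning r t a y)%R.
Proof.
rewrite /thinning !mulr_ge0 ?indicE ?invr_ge0 ?(intensity_ge0 hY)//.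
by rewrite ltW// (intensity_inf_gt0 hY).
Qed.

Lemma thinning_le1 r t a y : (thinning r t a y <= 1)%R.
Proof.
rewrite /thinning ler_pdivrMr ?(intensity_gt0 hY)// mul1r.
apply: le_trans (intensity_inf_le hY y).
have l0 := intensity_inf_gt0 hY.
by rewrite indicE; case: (_ \in _); rewrite ?mulr1 ?mulr0// ltW.
Qed.

Lemma measurable_thinning r t :
  measurable_fun setT (fun p : E * E => thinning r t p.1 p.2).
Proof.
rewrite /thinning; apply: measurable_funM.
  apply: measurable_funM => //.
  apply: eq_measurable_fun (measurable_indic (measurable_window_graph r t)) => p _.
  rewrite !indicE; suff -> : (p \in [set p | window r t p.1 p.2]) =
    (p.2 \in window r t p.1) by [].
  by apply/idP/idP; rewrite !inE.
have mi : measurable_fun setT (fun y : E => (intensity rho y)^-1)%R.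
  under eq_fun do rewrite -powR_inv1 ?(intensity_ge0 hY)//.
  apply: (@measurableT_comp _ _ _ _ _ _ (fun x : R => powR x (-1)%R)) => //.
  exact: (measurable_intensity hY).
by have h := measurableT_comp mi (@measurable_snd _ _ E E); exact h.
Qed.

Lemma prod_thinning r t a (s : seq E) :
  (\prod_(y <- s) thinning r t a y =
   lam ^+ size s * indicator_prod (window r t a) s / \prod_(y <- s) intensity rho y)%R.
Proof.
elim: s => [|y s IH]; first by rewrite /indicator_prod !big_nil expr0 !mul1r invr1.
rewrite indicator_prod_cons !big_cons IH /thinning /= exprS.
by field; rewrite (gt_eqF (prod_intensity_gt0 hY s)) (gt_eqF (intensity_gt0 hY y)).
Qed.
End moments.

(** * The Campbell and Georgii-Nguyen-Zessin formulas *)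

Section campbell.
Context (R : realType) (d : nat) (dO : measure_display)
  (Omega : measurableType dO) (P : probability Omega R).
Variable Y : {RV P >-> config R d}.
Local Notation E := (spacetime R d).
Variables rho xi : forall n, n.-tuple E -> R.
Hypothesis hY : IRMS Y rho xi.
Hypothesis sY : forall w, simple_config (Y w).
Local Notation lam := (intensity_inf rho).
Local Notation leb := (lebesgue_spacetime R d).
Variables r t : R.
Hypotheses (r0 : (0 <= r)%R) (t0 : (0 <= t)%R).
Local Notation u := (thinning rho r t).
Local Notation S := (factorial_sum u).

Let u0 a y : (0 <= u a y)%R. Proof. exact: (thinning_ge0 hY). Qed.
Let mu := measurable_thinning hY r t.
Let mS n := measurable_factorial_sum u0 n mu.

Lemma measurable_factorial_sum_process n a :
  measurable_fun setT (fun w => S n (a, Y w)).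
Proof.
have mp : measurable_fun setT (fun w => (a, Y w)).
  apply/measurable_fun_pair; first exact: measurable_cst.
  exact: (measurable_funPT Y).
by have h := measurableT_comp (mS n) mp; exact h.
Qed.

Lemma prod_thinning_rho n a (z : n.+1.-tuple E) :
  ((\prod_(y <- z) u a y) * rho z =
   lam ^+ n.+1 * (indicator_prod (window r t a) z * rw_density rho z))%R.
Proof.
rewrite (prod_thinning hY) (rw_density_rho rho) size_tuple.
by rewrite -!mulrA; congr (_ * (_ * _))%R; rewrite mulrC.
Qed.

(** The definition of the product density of order n, for a product of n thinning weights. *)
Lemma mean_factorial_sum n a :
  \int[P]_w S n (a, Y w) = (lam ^+ n)%:E * window_moment rho r t n.
Proof.
case: n => [|n].
  rewrite /= integral_cst//= probability_setT mul1e expr0 mul1e.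
  rewrite /window_moment seq_integral0; last exact: (indicator_rw_density_ge0 hY).
  by rewrite /indicator_prod big_nil mulr1.
under eq_integral do rewrite factorial_sumE//.
case: (IRMS_density hY (ltn0Sn n)) => mr rr0 _ fin mom.
have mpr : measurable_fun setT (fun z : n.+1.-tuple E =>
  (\prod_(y <- z) u a y)%:E : \bar R).
  apply: seq_measurable_prod.
  have h := measurableT_comp mu (@measurable_pair1 _ _ E E a); exact h.
have := mom _ mpr (fun z => _); rewrite /factorial_moment => ->; last first.
  by move=> z; rewrite lee_fin prodr_ge0.
rewrite -(window_momentE hY _ _ a) /seq_integral -ge0_integralZl//; last 3 first.
- exact: (seq_measurable_indicator_rw_density hY (measurable_window r t a)).
- by move=> z _; exact: (indicator_rw_density_ge0 hY).
- by rewrite lee_fin exprn_ge0// ltW// (intensity_inf_gt0 hY).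
by apply: eq_integral => z _; rewrite -EFinM prod_thinning_rho EFinM.
Qed.

(** The number H_n(a) of the opening comment, a moment of the process seen from a. *)
Definition palm_moment n (a : E) : \bar R :=
  seq_integral leb n (fun s : seq E =>
    (indicator_prod (window r t a) s * rw_density rho (a :: s))%:E).

(** The summand of [factorial_sum] when the head of the tuple is the centre. *)
Let weight n (z : n.+1.-tuple E) : R :=
  (\prod_(i <- enum 'I_n) u (tnth z ord0) (tnth z (lift ord0 i)))%R.

Let weight_ge0 n (z : n.+1.-tuple E) : (0 <= weight z)%R.
Proof. by apply: prodr_ge0. Qed.

Let weight_cons n a (z : n.-tuple E) :
  weight [tuple of a :: z] = (\prod_(y <- z) u a y)%R.
Proof.
rewrite /weight tnth0 big_tuple -big_enum; apply: eq_bigr => i _.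
by rewrite tnthS.
Qed.

Let measurable_weight n : measurable_fun setT (@weight n).
Proof.
apply: measurable_prod => i _.
have mp : measurable_fun setT (fun z : n.+1.-tuple E => (tnth z ord0,
  tnth z (lift ord0 i))).
  by apply/measurable_fun_pair; exact: measurable_tnth.
by have h := measurableT_comp mu mp; exact h.
Qed.

Let weighted_rho n (z : n.+1.-tuple E) : \bar R := (weight z)%:E * (rho z)%:E.

Let measurable_weighted_rho n : measurable_fun setT (@weighted_rho n).
Proof.
case: (IRMS_density hY (ltn0Sn n)) => mr _ _ _ _.
apply: emeasurable_funM; apply/measurable_EFinP => //; exact: measurable_weight.
Qed.

Let weighted_rho_ge0 n (z : n.+1.-tuple E) : 0 <= weighted_rho z.
Proof. by rewrite mule_ge0// lee_fin// (rho_ge0 hY). Qed.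

Let inner_weighted_rho n a :
  \int[tuple_power leb n]_z weighted_rho [tuple of a :: z] =
  (intensity rho a * lam ^+ n)%:E * palm_moment n a.
Proof.
rewrite /palm_moment /seq_integral -ge0_integralZl//; last 3 first.
- apply/measurable_EFinP; apply: measurable_funM.
    by apply/measurable_EFinP; exact: (seq_measurable_indicator_prod (measurable_window
      r t a)).
  by apply/measurable_EFinP; exact: (seq_measurable_cons a (seq_measurable_rw_density hY)).
- by move=> z _; rewrite lee_fin mulr_ge0 ?indicator_prod_ge0// (rw_density_ge0 hY).
- by rewrite lee_fin mulr_ge0 ?exprn_ge0 ?(intensity_ge0 hY)// ltW// (intensity_inf_gt0 hY).
apply: eq_integral => z _; rewrite /weighted_rho weight_cons -!EFinM; congr EFin.
rewrite (prod_thinning hY) size_tuple.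
have -> := rw_density_rho rho [tuple of a :: z]; rewrite /= big_cons.
by field; rewrite (gt_eqF (prod_intensity_gt0 hY z)) (gt_eqF (intensity_gt0 hY a)).
Qed.

Variable plam : E * config R d -> R.
Hypothesis hp : papangelou Y plam.

Let palm_mass n (a : E) : \bar R := \int[P]_w (S n (a, Y w) * (plam (a, Y w))%:E).

Let measurable_integrand n :
  measurable_fun setT (fun p : E * Omega => S n (p.1, Y p.2) * (plam (p.1, Y p.2))%:E).
Proof.
have mp : measurable_fun setT (fun p : E * Omega => (p.1, Y p.2)).
  apply/measurable_fun_pair => //=.
  by have h := measurableT_comp (measurable_funPT Y) (@measurable_snd _ _ E Omega); exact h.
apply: emeasurable_funM.
  by have h := measurableT_comp (mS n) mp; exact h.
apply/measurable_EFinP.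
by have h := measurableT_comp (papangelou_measurable hp) mp; exact h.
Qed.

Let integrand_ge0 n (p : E * Omega) : 0 <= S n (p.1, Y p.2) * (plam (p.1, Y p.2))%:E.
Proof. by rewrite mule_ge0 ?factorial_sum_ge0// lee_fin (papangelou_ge0 hp). Qed.

(** Both sides are the factorial moment of order n.+1 in which the head ranges over A and
the tail over the other points, weighted as seen from the head. *)
Let gnz n (A : set E) : measurable A ->
  \int[leb]_(a in A) palm_mass n a =
  \int[leb]_(a in A) \int[tuple_power leb n]_z weighted_rho [tuple of a :: z].
Proof.
move=> mA; pose g (p : E * config R d) : \bar R := (\1_A p.1)%:E * S n p.
have mg : measurable_fun setT g.
  apply: emeasurable_funM => //; apply/measurable_EFinP.
  have h := measurableT_comp (measurable_indic mA : measurable_fun setT (\1_A : E ->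
    R)) (@measurable_fst _ _ E (config R d)); exact h.
have g0 p : 0 <= g p by rewrite mule_ge0 ?factorial_sum_ge0// lee_fin.
have restr (f : E -> \bar R) a : (f \_ A) a = (\1_A a)%:E * f a.
  by rewrite patchE indicE; case: ifP => _; rewrite ?mul1e ?mul0e.
transitivity (\int[leb]_a \int[P]_w (g (a, Y w) * (plam (a, Y w))%:E)).
  rewrite integral_mkcond; apply: eq_integral => a _; rewrite restr.
  rewrite /palm_mass -ge0_integralZl//.
  - by apply: eq_integral => w _; rewrite /g /= muleA.
  - have mp := @measurable_pair1 _ _ E Omega a.
    by have h := measurableT_comp (measurable_integrand n) mp; exact h.
  - by move=> w _; exact: (integrand_ge0 n (a, w)).
rewrite -(papangelou_GNZ hp mg g0).
(* the function whose factorial moment both sides compute *)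
pose h (z : n.+1.-tuple E) : \bar R := (\1_A (tnth z ord0))%:E * (weight z)%:E.
have h0 z : 0 <= h z by rewrite mule_ge0// lee_fin.
have mh : measurable_fun setT h.
  apply: emeasurable_funM; last by apply/measurable_EFinP; exact: measurable_weight.
  apply/measurable_EFinP.
  by have k := measurableT_comp (measurable_indic mA : measurable_fun setT (\1_A : E ->
    R)) (@measurable_tnth _ E n.+1 ord0); exact k.
transitivity (factorial_moment Y h).
  apply: eq_integral => w _; rewrite esum_distinct_cons//.
  apply: eq_esum => y _; rewrite /g factorial_sumE//; last exact: remove_simple.
  rewrite -esumZl//; last by move=> z; rewrite lee_fin prodr_ge0.
  by apply: eq_esum => z _; rewrite /h weight_cons tnth0.
case: (IRMS_density hY (ltn0Sn n)) => mr _ _ _ mom; rewrite mom//.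
rewrite integral_tuple_powerS; last 2 first.
- by apply: emeasurable_funM => //; exact/measurable_EFinP.
- by move=> z; rewrite mule_ge0// lee_fin (rho_ge0 hY).
rewrite [RHS]integral_mkcond; apply: eq_integral => a _; rewrite restr.
rewrite -ge0_integralZl//; last first.
- have mc : measurable_fun setT (fun z : n.-tuple E => [tuple of a :: z]).
    exact: measurable_cons.
  by have k := measurableT_comp (@measurable_weighted_rho n) mc; exact k.
by apply: eq_integral => z _; rewrite /h /weighted_rho tnth0 muleA.
Qed.

(** Two functions with equal integrals over all measurable sets agree almost everywhere,
provided one is integrable. It is so on each cylinder: the tail of a tuple with nonzero
weight lies in a larger cylinder, the weights are at most 1, and factorial moments are
locally finite. *)
Lemma palm_mass_moment n : {ae leb, forall a : E,
  \int[P]_w (S n (a, Y w) * (plam (a, Y w))%:E) =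
  (intensity rho a * lam ^+ n)%:E * palm_moment n a}.
Proof.
pose f2 (a : E) := \int[tuple_power leb n]_z weighted_rho [tuple of a :: z].
have mf2 : measurable_fun setT f2.
  exact: (measurable_integral_cons _ (@measurable_weighted_rho n) (@weighted_rho_ge0 n)).
have mf1 : measurable_fun setT (palm_mass n).
  by have k := measurable_fun_fubini_tonelli_F (m2 := P) _ (measurable_integrand n)
    (integrand_ge0 n); exact k.
have f20 a : 0 <= f2 a by apply: integral_ge0 => z _; exact: weighted_rho_ge0.
have eqk (k : nat) : ae_eq leb (cyl k%:R k%:R) f2 (palm_mass n).
  apply: integral_ae_eq.
  - exact: measurable_cyl.
  - apply/integrableP; split; first exact: measurable_funTS.
    under eq_integral do rewrite gee0_abs//.
    (* cyl N M contains the window of every point of cyl k k *)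
    pose N : R := Num.sqrt (2 * (k%:R ^+ 2 + r ^+ 2)).
    pose M : R := (k%:R + t)%R.
    case: (IRMS_density hY (ltn0Sn n)) => mr _ _ fin mom.
    have mI : measurable_fun setT (fun z : n.+1.-tuple E =>
      (\1_(cyln N M n.+1) z)%:E : \bar R).
      apply: eq_measurable_fun (@seq_measurable_indicator_prod R d _ (measurable_cyl N
        M) n.+1) => z _.
      by rewrite /= indicator_prod_cyl.
    have := fin N M; rewrite mom//; apply: le_lt_trans.
    rewrite integral_tuple_powerS; last 2 first.
    + by apply: emeasurable_funM => //; exact/measurable_EFinP.
    + by move=> z; rewrite mule_ge0// lee_fin// (rho_ge0 hY).
    have mIr : measurable_fun setT (fun z : n.+1.-tuple E =>
        (\1_(cyln N M n.+1) z)%:E * (rho z)%:E).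
      by apply: emeasurable_funM => //; exact/measurable_EFinP.
    have Ir0 (z : n.+1.-tuple E) : 0 <= (\1_(cyln N M n.+1) z)%:E * (rho z)%:E.
      by rewrite mule_ge0// lee_fin// (rho_ge0 hY).
    rewrite integral_mkcond; apply: ge0_le_integral.
    + by [].
    + by move=> a _; rewrite patchE; case: ifP.
    + apply/(measurable_restrictT f2 (measurable_cyl k%:R k%:R)).
      exact: measurable_funTS.
    + exact: (measurable_integral_cons _ mIr Ir0).
    move=> a _; rewrite patchE; case: ifPn => [|_]; last first.
      by apply: integral_ge0 => z _; exact: Ir0.
    rewrite inE => ka; apply: ge0_le_integral => //.
    + have mc : measurable_fun setT (fun z : n.-tuple E => [tuple of a :: z]).
        exact: measurable_cons.
      by have h := measurableT_comp (@measurable_weighted_rho n) mc; exact h.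
    + have mc : measurable_fun setT (fun z : n.-tuple E => [tuple of a :: z]).
        exact: measurable_cons.
      by have h := measurableT_comp mIr mc; exact h.
    move=> z _; rewrite /weighted_rho; apply: lee_wpmul2r.
      by rewrite lee_fin (rho_ge0 hY).
    rewrite lee_fin weight_cons -indicator_prod_cyl /= indicator_prod_cons.
    have win y : window r t a y -> cyl N M y by exact: window_bounded.
    have aa : cyl N M a.
      apply: win; rewrite /window /= subrr normr0; split => //.
      rewrite /enorm big1 ?sqrtr0// => i _.
      by rewrite tnth_mktuple subrr expr0n.
    rewrite indicE mem_set// mul1r; apply: ler_prod => y _.
    rewrite u0/= indicE; case: (boolP (y \in cyl N M)) => [_|ny].
      exact: (thinning_le1 hY).
    rewrite /thinning indicE memNset ?mulr0 ?mul0r// => /win yw.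
    by move: ny; rewrite notin_setE.
  - exact: measurable_funTS.
  - by move=> A _ mA; apply/esym; exact: gnz.
have : {ae leb, forall a : E, forall k : nat, cyl k%:R k%:R a -> f2 a = palm_mass n a}.
  apply/ae_foralln => k; case: (eqk k) => M [mM M0 kM].
  exists M; split => // a /= nak; apply: kM => /= h; exact: nak.
apply: filterS => a h; have [k ka] := cyl_cover a.
by rewrite -inner_weighted_rho; exact/esym/(h k ka).
Qed.
End campbell.

(** * Local integrability of the correlation functions *)

(** The full mask puts all the other points in the block of the first one; every other mask
leads to a correlation function of lower order. *)
Lemma masks_full n : exists ms, masks n = nseq n true :: ms /\
  forall b, b \in ms -> size b = n /\ (count id b < n)%N.
Proof.
elim: n => [|n [ms [msE hms]]]; first by exists [::].
exists (map (cons true) ms ++ map (cons false) (masks n)); split.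
  by rewrite /= msE.
move=> b; rewrite mem_cat => /orP[] /mapP[c cm ->] /=.
  by have [-> lt] := hms c cm; rewrite add1n ltnS.
have sc := size_masks cm; rewrite sc; split => //.
by rewrite add0n ltnS -sc count_size.
Qed.

Section correlation_integrability.
Context (R : realType) (d : nat) (dO : measure_display)
  (Omega : measurableType dO) (P : probability Omega R).
Variable Y : {RV P >-> config R d}.
Local Notation E := (spacetime R d).
Variables rho xi xi' : forall n, n.-tuple E -> R.
Hypothesis hY : IRMS Y rho xi.
Hypothesis hxi' : invariant_version xi xi'.
Local Notation leb := (lebesgue_spacetime R d).
Local Notation Xi := (seqfun xi').

Lemma seq_measurable_correlation : seq_measurable (fun s : seq E => (Xi s)%:E).
Proof.
case=> [|n].
  apply: eq_measurable_fun (@measurable_cst _ _ _ _ setT ((Xi [::])%:E)) => z _.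
  by rewrite tuple0.
have [mx _ _] := hxi' (ltn0Sn n); apply/measurable_EFinP.
by apply: eq_measurable_fun mx => z _; rewrite seqfunE.
Qed.

(** [rw_density_cons] with the invariant version of xi, at tuples all of whose subsequences
are regular. The masks act on the whole tuple, head included, so that [seq_integral_mask]
applies. *)
Lemma rw_density_recursion n : {ae tuple_power leb n.+1, forall z : n.+1.-tuple E,
  rw_density rho z = (\sum_(b <- masks n) Xi (mask (true :: b) z) *
                 rw_density rho (mask (false :: map negb b) z))%R}.
Proof.
have st k : (0 < k)%N -> {ae tuple_power leb k, forall z : k.-tuple E,
    Xi z = seqfun xi z}.
  by move=> k0; have [_ _] := hxi' k0; apply: filterS => z h; rewrite !seqfunE h.
have := @ae_subseq _ E R leb (fun s => Xi s = seqfun xi s) st n.+1.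
apply: filterS => z h; case/tupleP: z h => x s h.
rewrite [X in rw_density rho X]/= (rw_density_cons (IRMS_correlation hY)) size_tuple
  !big_seq.
apply: eq_bigr => b /size_masks sb; congr (_ * _)%R.
by rewrite -h//= eqxx mask_subseq.
Qed.

Lemma seq_measurable_correlation_abs B : measurable B ->
  seq_measurable (fun s : seq E => (`|Xi s| * indicator_prod B s)%:E).
Proof.
move=> mB n; apply/measurable_EFinP; apply: measurable_funM.
  apply: (@measurableT_comp _ _ _ _ _ _ (@Num.norm R R)) => //.
  by apply/measurable_EFinP; exact: seq_measurable_correlation.
by apply/measurable_EFinP; exact: seq_measurable_indicator_prod.
Qed.

(** Strong induction on the order. In [rw_density_recursion] the full mask contributes the
correlation function of highest order, which is therefore bounded by the reweighted density
plus products, in disjoint variables, of integrable functions. *)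
Lemma seq_integral_correlation_lty (r t : R) n :
  seq_integral leb n.+1 (fun s : seq E =>
    (`|Xi s| * indicator_prod (cyl r t) s)%:E) < +oo.
Proof.
elim/ltn_ind: n => n IH.
set B := cyl r t; have mB : measurable B by exact: measurable_cyl.
pose F (s : seq E) : \bar R := (`|Xi s| * indicator_prod B s)%:E.
pose H (s : seq E) : \bar R := (indicator_prod B s * rw_density rho s)%:E.
have mF : seq_measurable F by exact: seq_measurable_correlation_abs.
have mH : seq_measurable H by exact: (seq_measurable_indicator_rw_density hY).
have F0 s : 0 <= F s by rewrite lee_fin mulr_ge0 ?indicator_prod_ge0.
have H0 s : 0 <= H s by exact: (indicator_rw_density_ge0 hY).
have Hoo k : seq_integral leb k H < +oo by exact: (seq_integral_rw_density_lty hY).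
have [ms [msE hms]] := masks_full n.
pose term b (s : seq E) := F (mask (true :: b) s) * H (mask (false :: map negb b) s).
have term0 b s : 0 <= term b s by exact: mule_ge0.
have mterm b : measurable_fun setT (fun z : n.+1.-tuple E => term b z).
  by apply: emeasurable_funM; exact: seq_measurable_mask.
apply: (@le_lt_trans _ _ (seq_integral leb n.+1
  (fun s => H s + \sum_(b <- ms) term b s))).
  apply: ae_ge0_le_integral => //.
  - by move=> z _; exact: F0.
  - exact: mF.
  - by move=> z _; rewrite adde_ge0// sume_ge0.
  - by apply: emeasurable_funD; [exact: mH|exact: emeasurable_sum].
  have := rw_density_recursion n; apply: filterS => z rec _.
  move: rec; rewrite msE big_cons.
  have -> : mask (true :: nseq n true) z = z.
    by rewrite -[true :: _]/(nseq n.+1 true) mask_true// size_tuple.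
  have -> : mask (false :: map negb (nseq n true)) z = [::].
    by rewrite map_nseq -[false :: _]/(nseq n.+1 false) mask_false.
  rewrite [rw_density rho [::]]/= mulr1 => /esym/(canRL (addrK _)) XiE.
  have -> : \sum_(b <- ms) term b z = (\sum_(b <- ms)
      `|Xi (mask (true :: b) z)| * rw_density rho (mask (false :: map negb b) z) *
      indicator_prod B z)%:E.
    rewrite -sumEFin big_seq [RHS]big_seq; apply: eq_bigr => b /hms[sb _].
    rewrite /term /F /H -EFinM; congr EFin.
    rewrite (@indicator_prod_mask _ _ B (true :: b) z); last first.
      by rewrite /= sb size_tuple.
    by ring.
  rewrite /F /H -EFinD lee_fin -mulr_suml [(_ * rw_density rho z)%R]mulrC -mulrDl.
  rewrite ler_wpM2r ?indicator_prod_ge0// XiE.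
  apply: le_trans (ler_normB _ _) _; rewrite ger0_norm ?(rw_density_ge0 hY)//.
  rewrite lerD2l; apply: le_trans (ler_norm_sum _ _ _) _; apply: ler_sum => b _.
  by rewrite normrM [X in (_ * X)%R]ger0_norm// (rw_density_ge0 hY).
have -> : seq_integral leb n.+1 (fun s => H s + \sum_(b <- ms) term b s) =
    seq_integral leb n.+1 H + \sum_(b <- ms) seq_integral leb n.+1 (term b).
  rewrite /seq_integral ge0_integralD//; last 3 first.
  - exact: mH.
  - by move=> z _; exact: sume_ge0.
  - exact: emeasurable_sum.
  congr (_ + _); rewrite ge0_integral_sum//.
rewrite lte_add_pinfty//.
rewrite big_seq; apply: lte_sum_pinfty => b /hms[sb cb].
have sb' : size (true :: b) = n.+1 by rewrite /= sb.
rewrite (seq_integral_mask leb sb' mF F0 mH H0).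
rewrite lte_mul_pinfty//.
- exact: seq_integral_ge0.
- by rewrite ge0_fin_numE ?seq_integral_ge0//=; exact: IH.
Qed.
End correlation_integrability.

(** * Moments seen from a point *)

Section palm_decomposition.
Context (R : realType) (d : nat) (dO : measure_display)
  (Omega : measurableType dO) (P : probability Omega R).
Variable Y : {RV P >-> config R d}.
Local Notation E := (spacetime R d).
Variables rho xi xi' : forall n, n.-tuple E -> R.
Hypothesis hY : IRMS Y rho xi.
Hypothesis hxi' : invariant_version xi xi'.
Variables r t : R.
Hypotheses (r0 : (0 <= r)%R) (t0 : (0 <= t)%R).
Local Notation leb := (lebesgue_spacetime R d).
Local Notation Xi := (seqfun xi').
Local Notation wind a := (indicator_prod (window r t a)).

(** The integrals defining J_coef, taken with the first point at a and over the window of a,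
converge absolutely. *)
Definition finite_sections (a : E) := forall k,
  seq_integral leb k (fun s : seq E => (`|Xi (a :: s)| * wind a s)%:E) < +oo.

(** Tonelli in the first point: the integral over a cylinder containing all the nearby
windows is finite. *)
Lemma ae_finite_sections : {ae leb, forall a : E, finite_sections a}.
Proof.
apply/ae_foralln => k.
pose B (N : nat) : set E := cyl (Num.sqrt (2 * (N%:R ^+ 2 + r ^+ 2))) (N%:R + t).
pose F N (s : seq E) : \bar R := (`|Xi s| * indicator_prod (B N) s)%:E.
have mB N : measurable (B N) by exact: measurable_cyl.
have mF N : seq_measurable (F N) by exact: (seq_measurable_correlation_abs hxi').
have F0 N s : 0 <= F N s by rewrite lee_fin mulr_ge0 ?indicator_prod_ge0.
have : {ae leb, forall a : E, forall N, seq_integral leb k (fun s => F N (a :: s)) < +oo}.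
  apply/ae_foralln => N.
  apply: ae_lty_integral; first exact: measurable_seq_integral.
    by move=> a; exact: seq_integral_ge0.
  by rewrite -seq_integralS//; exact: (seq_integral_correlation_lty hY).
apply: filterS => a h; have [N Na] := cyl_cover a.
apply: le_lt_trans (h N); apply: ge0_le_integral => //.
- by move=> z _; rewrite lee_fin mulr_ge0 ?indicator_prod_ge0.
- apply/measurable_EFinP; apply: measurable_funM.
    apply: (@measurableT_comp _ _ _ _ _ _ (@Num.norm R R)) => //.
    by apply/measurable_EFinP; exact: (seq_measurable_cons a
      (seq_measurable_correlation hxi')).
  apply/measurable_EFinP; exact: (seq_measurable_indicator_prod (measurable_window r t a)).
- exact: (seq_measurable_cons a (mF N)).
have win y : window r t a y -> B N y by exact: window_bounded.
have aa : B N a.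
  apply: win; rewrite /window /= subrr normr0; split => //.
  rewrite /enorm big1 ?sqrtr0// => i _.
  by rewrite tnth_mktuple subrr expr0n.
move=> z _; rewrite lee_fin ler_wpM2l// indicator_prod_cons indicE mem_set// mul1r.
apply: ler_prod => y _; rewrite !indicE; case: (boolP (y \in window r t a)) => [|_].
  by rewrite inE => /win yB; rewrite mem_set// ler01 lexx.
by rewrite lexx ler0n.
Qed.

Lemma measurable_section a : seq_measurable (fun s : seq E => (Xi (a :: s) * wind a s)%:E).
Proof.
move=> n; apply/measurable_EFinP; apply: measurable_funM.
  by apply/measurable_EFinP; exact: (seq_measurable_cons a (seq_measurable_correlation
    hxi')).
by apply/measurable_EFinP; exact: (seq_measurable_indicator_prod (measurable_window r t a)).
Qed.

Lemma correlation_translate a s : (0 < size s)%N ->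
  Xi (map (translate a) s) = Xi s.
Proof.
move=> s0; have [_ inv _] := hxi' s0.
rewrite -[in RHS](in_tupleE s) seqfunE -(inv a (in_tuple s)).
by rewrite -[map _ _]/(val (translate_tuple a (in_tuple s))) seqfunE.
Qed.

(** Translating a to the origin moves the window of a to the cylinder and does not change
the invariant version. *)
Lemma section_integral a k : finite_sections a ->
  seq_integral leb k (fun s : seq E => (Xi (a :: s) * wind a s)%:E) =
  (J_coef xi' r t k)%:E.
Proof.
move=> fa; set I := LHS.
have Ifin : I \is a fin_num.
  rewrite fin_num_abs; apply: le_lt_trans (fa k).
  apply: le_trans (le_abse_integral _ _ _) _ => //; first exact: measurable_section.
  rewrite le_eqVlt; apply/orP; left; apply/eqP; apply: eq_integral => z _ /=.
  by rewrite normrM [X in (_ * X)%R]ger0_norm// indicator_prod_ge0.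
rewrite -(fineK Ifin) /J_coef /Rintegral; congr (fine _)%:E.
rewrite /I -(seq_integral_map k (translate_invariant a) (measurable_section a)).
rewrite [RHS]integral_mkcond; apply: eq_integral => z _.
rewrite patchE indicator_window_translate -{1}(translate_origin a) -map_cons.
rewrite correlation_translate// indicator_prod_cyl indicE.
have -> : Xi (origin R d :: z) = xi' [tuple of origin R d :: z] by rewrite -seqfunE.
by case: ifP => _; rewrite ?mulr1 ?mulr0.
Qed.

Lemma ae_correlation1 : {ae leb, forall a : E, Xi [:: a] = 1%R}.
Proof.
have [_ _ ae1] := hxi' (ltn0Sn 0).
have := ae_tuple_cons ae1; apply: filterS => a [N [mN N0 hN]].
apply: contrapT => Xa; have : N [tuple].
  apply: hN => /= h; apply: Xa.
  have := (IRMS_correlation hY).1 [tuple a]; rewrite -seqfunE => <-.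
  by rewrite seqfunE -h -seqfunE.
move=> Nt; move: N0; rewrite /= /tuple_power0 diracE mem_set// => /eqP.
by rewrite onee_eq0.
Qed.

(** Integrate the recursion for almost every first point a. The indicator of the window
splits along each mask, so every term is a product of two integrals: one is J_coef, the
other a window moment. *)
Lemma ae_palm_moment : {ae leb, forall a : E, forall n,
  palm_moment rho r t n a = (\sum_(b <- masks n)
    J_coef xi' r t (count id b) *
    fine (window_moment rho r t (count negb b)))%:E}.
Proof.
have rec : {ae leb, forall a : E, forall n, {ae tuple_power leb n, forall s : n.-tuple E,
    rw_density rho (a :: s) = (\sum_(b <- masks n) Xi (a :: mask b s) *
                 rw_density rho (mask (map negb b) s))%R}}.
  apply/ae_foralln => n; have := ae_tuple_cons (rw_density_recursion hY hxi' n).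
  by apply: filterS => a; apply: filterS => s.
apply: filterS2 ae_finite_sections rec => a fa reca n.
pose F (s : seq E) : R := (Xi (a :: s) * wind a s)%R.
pose H (s : seq E) : R := (wind a s * rw_density rho s)%R.
have mF : seq_measurable (EFin \o F) by exact: measurable_section.
have mH : seq_measurable (EFin \o H).
  exact: (seq_measurable_indicator_rw_density hY (measurable_window r t a)).
have H0 s : (0 <= H s)%R by rewrite -lee_fin; exact: (indicator_rw_density_ge0 hY).
have HE0 s : 0 <= (EFin \o H) s by rewrite lee_fin.
have Hk k : seq_integral leb k (EFin \o H) = window_moment rho r t k.
  exact: (window_momentE hY).
have Hoo k : window_moment rho r t k < +oo by exact: (seq_integral_rw_density_lty hY).
have absF s : (`|F s| = `|Xi (a :: s)| * wind a s)%R.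
  by rewrite normrM [X in (_ * X)%R]ger0_norm// indicator_prod_ge0.
have Foo k : seq_integral leb k (fun s => `|F s|%:E) < +oo.
  by under eq_fun do rewrite absF; exact: fa.
have mFa : seq_measurable (fun s => `|F s|%:E).
  move=> k; apply/measurable_EFinP; apply: (@measurableT_comp _ _ _ _ _ _ (@Num.norm R
    R)) => //.
  by apply/measurable_EFinP; exact: mF.
have Fa0 s : 0 <= `|F s|%:E by rewrite lee_fin.
(* masks of the wrong size are sent to 0 so that every term is integrable *)
pose term (b : bitseq) (s : seq E) : \bar R :=
  if size b == n then (F (mask b s) * H (mask (map negb b) s))%:E else 0.
have mterm b : measurable_fun setT (fun z : n.-tuple E => term b z).
  rewrite /term; case: (size b == n); last exact: measurable_cst.
  apply/measurable_EFinP; apply: measurable_funM; apply/measurable_EFinP.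
    exact: (seq_measurable_mask b mF).
  exact: (seq_measurable_mask (map negb b) mH).
have iterm b : (tuple_power leb n).-integrable setT (fun z : n.-tuple E => term b z).
  apply/integrableP; split => //; rewrite /term.
  have [sb|_] := eqVneq (size b) n; last first.
    by under eq_integral do rewrite abse0; rewrite integral0.
  have := seq_integral_mask leb sb mFa Fa0 mH HE0.
  rewrite /seq_integral; under [X in X = _ -> _]eq_integral do rewrite -EFinM.
  under [X in _ -> X < _]eq_integral do
    rewrite /= normrM [X in (_ * X)%R]ger0_norm//.
  move=> ->; rewrite lte_mul_pinfty//.
  - exact: (seq_integral_ge0 _ _ Fa0).
  - by rewrite ge0_fin_numE ?(seq_integral_ge0 _ _ Fa0)//; exact: Foo.
  - by have := Hoo (count negb b); rewrite -Hk.
transitivity (\int[tuple_power leb n]_z (\sum_(b <- masks n) term b z)).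
  apply: ae_eq_integral => //.
  - apply/measurable_EFinP; apply: measurable_funM; apply/measurable_EFinP.
      exact: (seq_measurable_indicator_prod (measurable_window r t a)).
    exact: (seq_measurable_cons a (seq_measurable_rw_density hY)).
  - exact: emeasurable_sum.
  - have := reca n; apply: filterS => s h _; rewrite h mulr_sumr -sumEFin.
    rewrite !big_seq; apply: eq_bigr => b /size_masks sb.
    rewrite /term sb eqxx; congr EFin.
    rewrite (@indicator_prod_mask _ _ _ b s) ?sb ?size_tuple//.
    by rewrite /F /H; ring.
rewrite integral_sum// -sumEFin !big_seq; apply: eq_bigr => b /size_masks sb.
have := seq_integral_maskr sb mF mH H0 (Foo _).
rewrite Hk => /(_ (Hoo _)); rewrite {1}/seq_integral /term sb eqxx => ->.
have wfin : window_moment rho r t (count negb b) \is a fin_num.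
  by rewrite ge0_fin_numE// -Hk; exact: seq_integral_ge0.
by rewrite (section_integral _ fa) -(fineK wfin) EFinM.
Qed.
End palm_decomposition.

(** * The product W as a series *)

(** Only the number of selected positions matters, so this is the binomial sum; the first
bit of the mask gives Pascal's rule. *)
Lemma sum_masks_binomial (K : comPzRingType) (f g : nat -> K) n :
  (\sum_(b <- masks n) f (count id b) * g (count negb b) =
   \sum_(k < n.+1) 'C(n, k)%:R * (f k * g (n - k)%N))%R.
Proof.
elim: n f g => [|n IH] f g.
  by rewrite big_seq1 big_ord1 mul1r.
rewrite /= big_cat !big_map/=.
have IHf := IH (fun k => f k.+1) g; have IHg := IH f (fun k => g k.+1).
under [X in (X + _)%R]eq_bigr do rewrite add1n add0n.
under [X in (_ + X)%R]eq_bigr do rewrite add1n add0n.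
rewrite IHf IHg [RHS]big_ord_recl/= bin0 subn0.
have -> : (\sum_(i < n.+1) 'C(n.+1, bump 0 i)%:R *
    (f (bump 0 i) * g (n.+1 - bump 0 i)%N) =
  \sum_(i < n.+1) 'C(n, i)%:R * (f i.+1 * g (n - i)%N) +
  \sum_(i < n.+1) 'C(n, i.+1)%:R * (f i.+1 * g (n - i)%N))%R.
  rewrite -big_split/=; apply: eq_bigr => i _.
  by rewrite /bump add1n subSS binS natrD -mulrDl addrC.
rewrite addrCA; congr (_ + _)%R.
rewrite big_ord_recl/= bin0 subn0; congr (_ + _)%R.
rewrite [RHS]big_ord_recr/= bin_small// mul0r addr0.
by apply: eq_bigr => i _; rewrite /bump add1n -subSn// subSS.
Qed.

Lemma sum_masks_cauchy_product (R : realType) (f g : nat -> R) n :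
  ((\sum_(b <- masks n) f (count id b) * g (count negb b)) / n`!%:R =
   cauchy_product (fun k => f k / k`!%:R) (fun k => g k / k`!%:R) n)%R.
Proof.
rewrite sum_masks_binomial mulr_suml; apply: eq_bigr => -[k kn] _ /=.
rewrite ltnS in kn.
have nz m : (m`!%:R != 0 :> R)%R by rewrite pnatr_eq0 -lt0n fact_gt0.
have := bin_fact kn => /(congr1 (fun m => m%:R : R)); rewrite !natrM => <-.
have b0 : ('C(n, k)%:R != 0 :> R)%R by rewrite pnatr_eq0 -lt0n bin_gt0.
by field; rewrite b0 !nz.
Qed.

Section thinning_product.
Context (R : realType) (d : nat) (dO : measure_display)
  (Omega : measurableType dO) (P : probability Omega R).
Variable Y : {RV P >-> config R d}.
Local Notation E := (spacetime R d).
Variables rho xi : forall n, n.-tuple E -> R.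
Hypothesis hY : IRMS Y rho xi.
Variables r t : R.
Hypothesis r0 : (0 <= r)%R.
Local Notation u := (thinning rho r t).
Local Notation S := (factorial_sum u).

Lemma W_prod_ge0 a phi : (0 <= W_prod rho r t a phi)%R.
Proof.
rewrite /W_prod; apply: prodr_ge0 => y _; rewrite subr_ge0.
exact: (thinning_le1 hY r t a y).
Qed.

(** The series stops after as many terms as there are points in the window. *)
Lemma W_prod_expansion a phi : simple_config phi ->
  (forall n, S n (a, phi) \is a fin_num) /\
  series (fun n => (-1) ^+ n * (fine (S n (a, phi)) / n`!%:R))%R @ \oo -->
    W_prod rho r t a phi.
Proof.
move=> sphi; have [X [uX Xphi phiX]] := window_points t a phi r0.
have u0 b y := thinning_ge0 hY r t b y.
have uX0 y : points phi y -> y \notin X -> u a y = 0%R.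
  move=> py yX; rewrite /thinning indicE memNset ?mulr0 ?mul0r//.
  exact: phiX.
have SE n : S n (a, phi) = (distinct_sum (u a) n X)%:E.
  exact: (factorial_sum_distinct_sum n u0 (measurable_thinning hY r t)).
split => [n|]; first by rewrite SE.
have -> : W_prod rho r t a phi = (\prod_(y <- X) (1 - u a y))%R.
  rewrite /W_prod (fsbigE X)//; last first.
    by move=> y py yX; have := uX0 y py yX; rewrite /thinning => ->; rewrite subr0.
  by rewrite big_seq_cond [RHS]big_seq_cond; apply: eq_big => // y;
    rewrite andbT; case: (boolP (y \in X)) => //= yX; rewrite mem_set//; exact: Xphi.
apply: cvg_near_cst; exists (size X).+1 => // N /= XN.
rewrite series_ord -(alternating_distinct_sum (u a) uX XN).
apply: eq_bigr => i _; rewrite SE/=.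
by rewrite mulrA [LHS]mulrAC.
Qed.

Hypothesis sY : forall w, simple_config (Y w).

(** The weight Z will be 1 and the Papangelou intensity at a divided by the intensity. *)
Lemma integral_W_prod a (Z : Omega -> R) (e : nat -> R) :
  measurable_fun setT Z -> (forall w, (0 <= Z w)%R) ->
  (forall n, \int[P]_w ((Z w)%:E * S n (a, Y w)) = (e n)%:E) ->
  cvgn (series (fun n => e n / n`!%:R)%R) ->
  \int[P]_w (Z w * W_prod rho r t a (Y w))%:E =
  (limn (series (fun n => (-1) ^+ n * (e n / n`!%:R)))%R)%:E.
Proof.
move=> mZ Z0 eE ce.
have u0 b y := thinning_ge0 hY r t b y.
have S0 n w : 0 <= S n (a, Y w) by exact: factorial_sum_ge0.
have mS n := measurable_factorial_sum_process hY r t n a.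
have Sfin n w : S n (a, Y w) \is a fin_num by exact: (W_prod_expansion a (sY w)).1.
apply: (integral_alternating_series
  (F := fun n w => Z w * (fine (S n (a, Y w)) / n`!%:R))%R) => //.
- by move=> n w; rewrite mulr_ge0// divr_ge0// fine_ge0.
- move=> n; apply: measurable_funM => //; apply: measurable_funM => //.
  by apply: (@measurableT_comp _ _ _ _ _ _ fine).
- move=> n; rewrite [X in _ = X%:E]mulrC EFinM -eE -ge0_integralZl//.
  + apply: eq_integral => w _; rewrite -{2}(fineK (Sfin n w)) -!EFinM; congr EFin.
    by rewrite mulrA mulrC.
  + by apply: emeasurable_funM => //; exact/measurable_EFinP.
  + by move=> w _; rewrite mule_ge0// lee_fin.
- move=> w; have [_ cW] := W_prod_expansion a (sY w).
  have -> : series (fun n => (-1) ^+ n * (Z w * (fine (S n (a, Y w)) / n`!%:R)))%R =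
      (fun N => Z w * series (fun n => (-1) ^+ n * (fine (S n (a, Y w)) / n`!%:R)) N)%R.
    apply/funext => N; rewrite !series_ord mulr_sumr.
    by apply: eq_bigr => i _; rewrite mulrCA.
  by apply: cvgM => //; exact: cvg_cst.
Qed.
End thinning_product.

(** * The identity for an everywhere simple process *)

Section simple_process_case.
Context (R : realType) (d : nat) (dO : measure_display)
  (Omega : measurableType dO) (P : probability Omega R).
Variable Y : {RV P >-> config R d}.
Local Notation E := (spacetime R d).
Variables rho xi xi' : forall n, n.-tuple E -> R.
Hypothesis hY : IRMS Y rho xi.
Hypothesis hxi' : invariant_version xi xi'.
Variables r t : R.
Hypotheses (r0 : (0 <= r)%R) (t0 : (0 <= t)%R).
Hypothesis hJ : J_inhom_defined rho xi' r t.
Hypothesis hlimsup : limn_esup (fun n : nat =>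
       ((intensity_inf rho ^+ n / n`!%:R)%:E *
        \int[tuple_power (lebesgue_spacetime R d) n]_(z in cyln r t n)
          (reweighted_density rho z)%:E) `^ n%:R^-1) < 1.
Variable plam : E * config R d -> R.
Hypothesis hp : papangelou Y plam.
Hypothesis sY : forall w, simple_config (Y w).
Local Notation leb := (lebesgue_spacetime R d).
Local Notation lam := (intensity_inf rho).
Local Notation J := (J_coef xi' r t).
Let G k := fine (window_moment rho r t k).
(** Up to the sign (-1)^k, j has the terms of the series of J, and g those of the series of
E W. *)
Let j k : R := (lam ^+ k * J k / k`!%:R)%R.
Let g k : R := (lam ^+ k * G k / k`!%:R)%R.

Let window_moment_ge0 k : 0 <= window_moment rho r t k.
Proof. by apply: seq_integral_ge0 => s; exact: (indicator_rw_density_ge0 hY). Qed.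

Let GE k : window_moment rho r t k = (G k)%:E.
Proof.
by rewrite fineK// ge0_fin_numE//; exact: (seq_integral_rw_density_lty hY).
Qed.

Let g_ge0 k : (0 <= g k)%R.
Proof.
have l0 := intensity_inf_gt0 hY.
by rewrite divr_ge0// mulr_ge0 ?exprn_ge0 ?fine_ge0// ltW.
Qed.

Let is_cvg_g : cvgn (series g).
Proof.
apply: root_test => //; apply: le_lt_trans hlimsup.
rewrite le_eqVlt; apply/orP; left; apply/eqP; congr limn_esup; apply/funext => -[|n].
  by rewrite invr0 !poweRe0.
by rewrite (window_moment_cyln rho r t)// GE -EFinM /g mulrAC.
Qed.

Let is_cvg_g_norm : cvgn (series (fun n => `|g n|%R)).
Proof. by under eq_fun do rewrite ger0_norm//. Qed.

Let J_termE n : J_term rho xi' r t n = ((-1) ^+ n * j n)%R.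
Proof. by rewrite /J_term /j (exprNn lam); ring. Qed.

Let is_cvg_j_norm : cvgn (series (fun n => `|j n|%R)).
Proof.
rewrite -(is_cvg_series_restrict 1).
rewrite (_ : (fun N => \sum_(1 <= k < N) `|j k|)%R =
  (fun N => \sum_(1 <= k < N) `|J_term rho xi' r t k|)%R)//.
apply/funext => N; apply: eq_bigr => n _.
by rewrite J_termE [in RHS]normrM normrX normrN1 expr1n mul1r.
Qed.

Let alternating (a : nat -> R) n : R := ((-1) ^+ n * a n)%R.

Let norm_alternating b : (fun n => `|alternating b n|%R) = (fun n => `|b n|%R).
Proof.
by apply/funext => n; rewrite /alternating normrM normrX normrN1 expr1n mul1r.
Qed.

Let alternating_cauchy_product a b n :
  alternating (cauchy_product a b) n =
  cauchy_product (alternating a) (alternating b) n.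
Proof.
rewrite /alternating /cauchy_product mulr_sumr; apply: eq_bigr => -[k kn] _ /=.
have {1}-> : n = (k + (n - k))%N by rewrite subnKC// -ltnS.
by rewrite exprD; ring.
Qed.

Let J_inhomE : J 0 = 1%R -> J_inhom rho xi' r t = limn (series (alternating j)).
Proof.
move=> J0; have cj : cvgn (series (alternating j)).
  apply: normed_cvg; have := is_cvg_j_norm.
  by rewrite -(norm_alternating j).
have cr : cvgn (fun N => \sum_(1 <= n < N) J_term rho xi' r t n)%R.
  move: cj; rewrite -(is_cvg_series_restrict 1).
  rewrite (_ : (fun N => \sum_(1 <= k < N) alternating j k)%R =
    (fun N => \sum_(1 <= k < N) J_term rho xi' r t k)%R)//.
  by apply/funext => N; apply: eq_bigr => n _; rewrite J_termE.
rewrite /J_inhom; apply/esym/cvg_lim => //.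
have : (fun N => 1 + \sum_(1 <= n < N) J_term rho xi' r t n)%R @ \oo -->
    (1 + limn (fun N => \sum_(1 <= n < N) J_term rho xi' r t n))%R.
  by apply: cvgD => //; exact: cvg_cst.
apply: cvg_trans; apply: near_eq_cvg; exists 1%N => // N /= N1.
rewrite seriesEnat/= [(\sum_(0 <= _ < _) _)%R]big_ltn// /alternating {1}/j J0 !expr0
  fact0 mulr1n !mul1r invr1.
by congr (_ + _)%R; apply: eq_bigr => n _; rewrite J_termE.
Qed.

(** The weighted expansion has coefficients the Cauchy product of j and g, so its sum is the
product of the sums, which are J and E W. *)
Lemma J_inhom_identity_simple : {ae leb, forall a : E,
  exists EW : R, [/\
    \int[P]_w (W_prod rho r t a (Y w))%:E = EW%:E &
    \int[P]_w (plam (a, Y w) / intensity rho a * W_prod rho r t a (Y w))%:E =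
    (J_inhom rho xi' r t * EW)%:E]}.
Proof.
have palm := ae_palm_moment hY hxi' r0 t0.
have fin := ae_finite_sections hY hxi' r0 t0.
have one := ae_correlation1 hY hxi'.
have mass : {ae leb, forall a : E, forall n,
    \int[P]_w (factorial_sum (thinning rho r t) n (a, Y w) * (plam (a, Y w))%:E) =
    (intensity rho a * lam ^+ n)%:E * palm_moment rho r t n a}.
  by apply/ae_foralln => n; exact: (palm_mass_moment hY sY r0 t0 hp n).
apply: filterS2 (filterI palm fin) (filterI one mass) => a [palma fina] [onea massa].
have J0 : J 0 = 1%R.
  have := section_integral hxi' 0 fina.
  have m0 : seq_integral leb 0 (fun s : seq E =>
     (seqfun xi' (a :: s) * indicator_prod (window r t a) s)%:E) = 1.
    rewrite /seq_integral (eq_integral (cst 1)).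
      by rewrite /= integral_dirac// diracT mul1e.
    by move=> z _; rewrite (tuple0 z) /= onea /indicator_prod big_nil mulr1.
  by rewrite m0 => -[].
have ea := intensity_gt0 hY a.
have u0 b y := thinning_ge0 hY r t b y.
have EW : \int[P]_w (1 * W_prod rho r t a (Y w))%:E =
    (limn (series (alternating g)))%:E.
  rewrite (integral_W_prod hY r0 sY (Z := fun=> 1%R) (e := fun n => lam ^+ n * G n)%R)//.
  move=> n; under eq_integral do rewrite mul1e.
  by rewrite (mean_factorial_sum hY sY) GE.
exists (limn (series (alternating g))); split.
  by rewrite -EW; apply: eq_integral => w _; rewrite mul1r.
pose e n : R := (lam ^+ n * \sum_(b <- masks n) J (count id b) * G (count negb b))%R.
have eE n : (e n / n`!%:R = cauchy_product j g n)%R.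
  rewrite -(sum_masks_cauchy_product (fun k => lam ^+ k * J k) (fun k => lam ^+ k * G k))%R.
  congr (_ / _)%R; rewrite /e mulr_sumr !big_seq; apply: eq_bigr => b /size_masks sb.
  have -> : n = (count id b + count negb b)%N by rewrite (count_predC id b).
  by rewrite exprD; ring.
have mplam : measurable_fun setT (fun w => plam (a, Y w)).
  have mp : measurable_fun setT (fun w => (a, Y w)).
    apply/measurable_fun_pair; first exact: measurable_cst.
    exact: (measurable_funPT Y).
  by have h := measurableT_comp (papangelou_measurable hp) mp; exact h.
have inte n : \int[P]_w ((plam (a, Y w) / intensity rho a)%:E *
    factorial_sum (thinning rho r t) n (a, Y w)) = (e n)%:E.
  transitivity ((intensity rho a)^-1%:E * \int[P]_w
      (factorial_sum (thinning rho r t) n (a, Y w) * (plam (a, Y w))%:E)).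
    rewrite -ge0_integralZl//.
    - apply: eq_integral => w _; rewrite mulrC EFinM -muleA; congr (_ * _).
      by rewrite muleC.
    - apply: emeasurable_funM; last exact/measurable_EFinP.
      exact: (measurable_factorial_sum_process hY).
    - by move=> w _; rewrite mule_ge0 ?factorial_sum_ge0// lee_fin (papangelou_ge0 hp).
    - by rewrite lee_fin invr_ge0 ltW.
  rewrite massa palma -!EFinM; congr EFin.
  by rewrite !mulrA mulVf ?gt_eqF// mul1r.
have e0 n : (0 <= e n)%R.
  rewrite -lee_fin -inte; apply: integral_ge0 => w _.
  by rewrite mule_ge0 ?factorial_sum_ge0// lee_fin divr_ge0 ?(papangelou_ge0 hp)// ltW.
have ce : cvgn (series (fun n => e n / n`!%:R)%R).
  rewrite (_ : (fun n => e n / n`!%:R)%R = (fun n => `|cauchy_product j g n|)%R).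
    exact: is_cvg_normed_cauchy_product.
  by apply/funext => n; rewrite -eE ger0_norm// divr_ge0.
rewrite (integral_W_prod hY r0 sY (e := e))//; last 2 first.
- exact: measurable_funM.
- by move=> w; rewrite divr_ge0 ?(papangelou_ge0 hp)// ltW.
congr EFin; rewrite (J_inhomE J0).
have -> : series (fun n => (-1) ^+ n * (e n / n`!%:R))%R =
    series (cauchy_product (alternating j) (alternating g)).
  apply/funext => N; apply: eq_bigr => n _.
  by rewrite -alternating_cauchy_product eE.
by apply/cvg_lim => //; apply: cvg_cauchy_product; rewrite norm_alternating.
Qed.
End simple_process_case.

(** * The representation of J *)

Theorem theorem2 (R : realType) (d : nat) (hd : (0 < d)%N)
    (dO : measure_display) (Omega : measurableType dO)
    (P : probability Omega R) (Y : {RV P >-> config R d})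
    (hYsimple : simple_process Y)
    (rho xi xi' : forall n, n.-tuple (spacetime R d) -> R)
    (hY : IRMS Y rho xi) (hxi' : invariant_version xi xi')
    (r t : R) (hr : (0 <= r)%R) (ht : (0 <= t)%R)
    (hJ : J_inhom_defined rho xi' r t)
    (hlimsup : limn_esup (fun n : nat =>
       ((intensity_inf rho ^+ n / n`!%:R)%:E *
        \int[tuple_power (lebesgue_spacetime R d) n]_(z in cyln r t n)
          (reweighted_density rho z)%:E) `^ n%:R^-1) < 1)
    (plam : spacetime R d * config R d -> R) (hplam : papangelou Y plam) :
  \forall a \ae lebesgue_spacetime R d,
    0 < 'E_P[fun w => (plam (a, Y w) * W_prod rho r t a (Y w) / intensity rho a)%R] ->
    0 < 'E_P[fun w => W_prod rho r t a (Y w)] /\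
    (J_inhom rho xi' r t)%:E =
      'E_P[fun w => (plam (a, Y w) / intensity rho a * W_prod rho r t a (Y w))%R] /
      'E_P[fun w => W_prod rho r t a (Y w)].
Proof.
have [Z [sZ ZY]] := exists_simple_version hYsimple.
have hZ : IRMS Z rho xi.
  split; [move=> n n0|exact: IRMS_intensity hY|exact: IRMS_correlation hY
    |exact: IRMS_stationary hY].
  exact: product_density_version ZY _ _ (IRMS_density hY n0).
have pZ := papangelou_version ZY hplam.
have := J_inhom_identity_simple hZ hxi' hr ht hJ hlimsup pZ sZ.
apply: filterS => a [EW [EWE JE]].
have W0 phi : (0 <= W_prod rho r t a phi)%R by exact: (W_prod_ge0 hY).
have pW0 phi : (0 <= plam (a, phi) / intensity rho a * W_prod rho r t a phi)%R.
  by rewrite mulr_ge0// divr_ge0 ?(papangelou_ge0 hplam)// (intensity_ge0 hY).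
have EWY : 'E_P[fun w => W_prod rho r t a (Y w)] = EW%:E.
  rewrite unlock -EWE; apply: ge0_ae_eq_integral_nonmeasurable.
  - by move=> w; rewrite lee_fin.
  - by move=> w; rewrite lee_fin.
  - by apply: filterS ZY => w ->.
have JEY : 'E_P[fun w => (plam (a, Y w) / intensity rho a *
    W_prod rho r t a (Y w))%R] = (J_inhom rho xi' r t * EW)%:E.
  rewrite unlock -JE; apply: ge0_ae_eq_integral_nonmeasurable.
  - by move=> w; rewrite lee_fin.
  - by move=> w; rewrite lee_fin.
  - by apply: filterS ZY => w ->.
have -> : (fun w => plam (a, Y w) * W_prod rho r t a (Y w) / intensity rho a)%R =
    (fun w => plam (a, Y w) / intensity rho a * W_prod rho r t a (Y w))%R.
  by apply/funext => w; rewrite mulrAC.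
rewrite JEY EWY !lte_fin => JEW.
have EW0 : (0 <= EW)%R.
  by rewrite -lee_fin -EWE; apply: integral_ge0 => w _; rewrite lee_fin.
have EWn : EW != 0%R by apply: contraTneq JEW => ->; rewrite mulr0 ltxx.
split; first by rewrite lt_neqAle eq_sym EWn.
by rewrite inver (negbTE EWn) -EFinM mulfK.
Qed.
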